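(* As $n\to\infty$, the sequence of processes $\left(n^{-1/2}\mathbf{S}_{nt}\right)_{t\in[0,1]}$ conditioned by $\mathbf{S}_n=0$ (that is, for each $n\ge 1$, the random element of $C[0,1]$ whose law is the conditional law of $(n^{-1/2}\mathbf{S}_{nt})_{t\in[0,1]}$ given the event $\{\mathbf{S}_n=0\}$) converges in distribution to the Brownian bridge $\mathsf{b}$ in $C[0,1]$ equipped with the topology of uniform convergence.
   Context: Let $(P_j)_{j\ge 1}$ be i.i.d. Poisson random variables with parameter $1$. Set $\mathbf{S}_k=\sum_{j=1}^k (P_j-1)$ for every integer $k\ge 0$ (so $\mathbf{S}_0=0$), and extend $\mathbf{S}$ to real arguments by linear interpolation between consecutive integers. The Brownian bridge $\mathsf{b}=(\mathsf{b}(t))_{t\in[0,1]}$ is the continuous centered Gaussian process with $\mathrm{cov}(\mathsf{b}(s),\mathsf{b}(t))=s(1-t)$ for $0\le s\le t\le 1$. $C[0,1]$ is the space of continuous real-valued functions on $[0,1]$. *)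

(* Defs.v *)
From HB Require Import structures.
From mathcomp Require Import all_boot all_order all_algebra finmap.
From mathcomp Require Import all_classical all_reals all_analysis.

Set Implicit Arguments.
Unset Strict Implicit.
Unset Printing Implicit Defensive.

Import Order.TTheory GRing.Theory Num.Theory.
Import numFieldNormedType.Exports.

Local Open Scope classical_set_scope.
Local Open Scope ring_scope.

Definition unitI (R : realType) : Type := `[0 : R, 1]%classic.
HB.instance Definition _ (R : realType) := PseudoMetric.on (unitI R).

(* The space C[0,1], with the metric induced by the uniform one on the
   functions [0,1] -> R. *)
Definition C01 (R : realType) : Type :=
  initial_topology
    (fun f : continuousType (unitI R) R => (f : arrow_uniform_type (unitI R) R)).
HB.instance Definition _ (R : realType) := PseudoMetric.on (C01 R).
HB.instance Definition _ (R : realType) :=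
  isPointed.Build (C01 R) (cst 0 : continuousType (unitI R) R).

Definition C01_eval (R : realType) (f : C01 R) : unitI R -> R :=
  (f : continuousType (unitI R) R).

Definition borel (X : ptopologicalType) : Type :=
  g_sigma_algebraType (@open X).
HB.instance Definition _ (X : ptopologicalType) := Measurable.on (borel X).

Definition weak_cvg (R : realType) (X : ptopologicalType)
    (mu_ : nat -> probability (borel X) R) (mu : probability (borel X) R) :=
  forall f : X -> R, continuous f -> (exists M, forall x, `|f x| <= M) ->
    (\int[mu_ n]_x (f x)%:E)%E @[n --> \oo] --> (\int[mu]_x (f x)%:E)%E.

(* P(. | A); the convention of [mnormalize] is that this is P if P A = 0. *)
Definition cond_prob d (T : measurableType d) (R : realType)
    (P : probability T R) (A : set T) (mA : measurable A) : probability T R :=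
  mnormalize (mrestr P mA) P.

Definition mutually_independent d d' (T : measurableType d)
    (T' : measurableType d') (R : realType) (P : probability T R)
    (I : choiceType) (X : I -> {RV P >-> T'}) :=
  forall (J : {fset I}) (A : I -> set T'), (forall j, measurable (A j)) ->
    P (\bigcap_(j in [set` J]) (X j @^-1` A j)) =
    (\prod_(j <- J) P (X j @^-1` A j))%E.

(* The last argument of [poisson_prob] is not used by its definition. *)
Definition is_poisson d (T : measurableType d) (R : realType)
    (P : probability T R) (rate : R) (X : {RV P >-> nat}) :=
  forall A : set nat, distribution P X A = poisson_prob rate 0%N A.

(* [normal_prob m s] is the intended law only for s != 0. *)
Definition gaussian_prob (R : realType) (m s : R) (A : set R) : \bar R :=
  if s == 0 then \d_m A else normal_prob m s A.

Definition is_gaussian d (T : measurableType d) (R : realType)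
    (P : probability T R) (X : T -> R) :=
  exists m s : R, forall A : set R, measurable A ->
    pushforward P X A = gaussian_prob m s A.

Definition is_gaussian_process d (T : measurableType d) (R : realType)
    (P : probability T R) (I : Type) (X : I -> T -> R) :=
  forall (k : nat) (a : 'I_k -> R) (t : 'I_k -> I),
    is_gaussian P (fun w => \sum_(i < k) a i * X (t i) w).

Definition brownian_bridge d (T : measurableType d) (R : realType)
    (P : probability T R) (b : {RV P >-> borel (C01 R)}) :=
  let bt (t : unitI R) := fun w => C01_eval (b w) t in
  [/\ is_gaussian_process P bt,
      forall t, ('E_P[bt t] = 0)%E &
      forall s t : unitI R, set_val s <= set_val t ->
        covariance P (bt s) (bt t) = (set_val s * (1 - set_val t))%:E].

(* Linear interpolation of the sequence s, meaningful for x >= 0. *)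
Definition interp (R : realType) (s : nat -> R) (x : R) : R :=
  let k := Num.truncn x in s k + (x - k%:R) * (s k.+1 - s k).

Lemma interpE (R : realType) (s : nat -> R) (N : nat) (x : R) :
  0 <= x -> x < N%:R ->
  interp s x =
  s 0%N + \sum_(j < N) Num.max 0 (Num.min 1 (x - j%:R)) * (s j.+1 - s j).
Proof.
move=> x0; elim: N => [|N IH]; first by rewrite ltNge x0.
move=> xN; rewrite big_ord_recr/=.
have [{}xN'|Nx] := ltP x N%:R.
  rewrite IH// (_ : Num.max _ _ = 0) ?mul0r ?addr0//.
  by rewrite max_l// ge_min; apply/orP; right; rewrite subr_le0 ltW.
have kN : Num.truncn x = N by apply/eqP; rewrite truncn_eq// Nx xN.
rewrite /interp kN addrA; congr (_ + _); last first.
  rewrite min_r ?max_r ?subr_ge0//.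
  by rewrite lerBlDr addrC natr1 ltW.
rewrite (eq_bigr (fun j : 'I_N => s j.+1 - s j)).
  by rewrite -(big_mkord xpredT (fun j => s j.+1 - s j)) telescope_sumr// addrC subrK.
move=> j _; rewrite min_l ?max_r ?mul1r//.
by rewrite lerBrDl natr1 (le_trans _ Nx)// ler_nat.
Qed.

Definition scaled_interp (R : realType) (s : nat -> R) (n : nat)
    (t : unitI R) : R :=
  interp s (n%:R * set_val t) / Num.sqrt n%:R.

Lemma continuous_scaled_interp (R : realType) (s : nat -> R) (n : nat) :
  continuous (scaled_interp s n).
Proof.
pose g (x : R) := (s 0%N + \sum_(j < n.+1)
    Num.max 0 (Num.min 1 (n%:R * x - j%:R)) * (s j.+1 - s j)) / Num.sqrt n%:R.
have cg : continuous g.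
  move=> x; apply: cvgM; last exact: cvg_cst.
  apply: cvgD; first exact: cvg_cst.
  apply: cvg_big => [|j _]; first exact: add_continuous.
  apply: cvgM; last exact: cvg_cst.
  have cl : continuous (fun y : R => n%:R * y - j%:R).
    move=> y; apply: cvgB; last exact: cvg_cst.
    by apply: cvgM; [exact: cvg_cst|exact: cvg_id].
  have cm : continuous (cst (0 : R) \max (cst 1 \min (fun y : R => n%:R * y - j%:R))).
    apply: max_fun_continuous; first by move=> y; exact: cvg_cst.
    by apply: min_fun_continuous => // y; exact: cvg_cst.
  exact: cm.
have -> : scaled_interp s n = g \o (set_val : unitI R -> R).
  apply/funext => t; rewrite /scaled_interp (@interpE _ _ n.+1)//.
    have /set_mem/= := valP t; rewrite in_itv/= => /andP[t0 _].
    by rewrite mulr_ge0// ler0n.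
  have /set_mem/= := valP t; rewrite in_itv/= => /andP[t0 t1].
  by rewrite (@le_lt_trans _ _ n%:R) ?ltr_nat// ler_piMr// ler0n.
move=> t; apply: continuous_comp; last exact: cg.
exact: (@initial_continuous (unitI R) R set_val).
Qed.

Definition scaled_path (R : realType) (s : nat -> R) (n : nat) : C01 R :=
  mkcts (@continuous_scaled_interp R s n) : continuousType (unitI R) R.

Lemma scaled_pathE (R : realType) (s : nat -> R) (n : nat) (t : unitI R) :
  C01_eval (scaled_path s n) t = interp s (n%:R * set_val t) / Num.sqrt n%:R.
Proof. by []. Qed.

Section walk.
Context d (T : measurableType d) (R : realType) (P : probability T R).
Variable Poi : nat -> {RV P >-> nat}.

(* Poi j stands for the variable P_{j+1}. *)
Definition walk (k : nat) (w : T) : R := \sum_(j < k) ((Poi j w)%:R - 1).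

Definition walk_path (n : nat) (w : T) : borel (C01 R) :=
  scaled_path (walk ^~ w) n.

Lemma measurable_factor_nat d' (T' : measurableType d') (m : nat) (f : T -> T') :
  (forall w w', (forall j, (j < m)%N -> Poi j w = Poi j w') -> f w = f w') ->
  measurable_fun setT f.
Proof.
move=> fE _ B _; rewrite setTI.
pose Q (v : m.-tuple nat) := exists2 w, B (f w) & forall j : 'I_m, Poi j w = tnth v j.
pose F (v : m.-tuple nat) : set T :=
  [set w | Q v /\ (\bigcap_(j : 'I_m) (Poi j @^-1` [set tnth v j])) w].
have -> : f @^-1` B = \bigcup_v F v.
  apply/seteqP; split=> [w Bw|w [v _ [[w' Bw' w'E] wE]]].
    exists [tuple Poi j w | j < m] => //; split.
      by exists w => // j; rewrite tnth_mktuple.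
    by move=> j _ /=; rewrite tnth_mktuple.
  rewrite /preimage/= (fE w w')// => j jm.
  by have /= -> := wE (Ordinal jm) I; rewrite -w'E.
apply: countable_bigcupT_measurable; first exact: countableP.
move=> v; have [Qv|nQv] := pselect (Q v); last first.
  by rewrite (_ : F v = set0)//; apply/seteqP; split=> w // -[].
rewrite (_ : F v = \bigcap_(j : 'I_m) (Poi j @^-1` [set tnth v j])); last first.
  by apply/seteqP; split=> w // -[].
apply: fin_bigcap_measurable => [|j _]; first exact: finite_finset.
by rewrite -[X in measurable X]setTI; exact: measurable_funP.
Qed.

Lemma measurable_walk0 (n : nat) : measurable [set w | walk n w = 0].
Proof.
have mw : measurable_fun setT (walk n).
  apply: (@measurable_factor_nat _ _ n) => w w' ww'.
  by apply: eq_bigr => j _; rewrite ww'.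
by rewrite -[X in measurable X]setTI; exact: (mw measurableT [set 0] (measurable_set1 0)).
Qed.

Lemma measurable_walk_path (n : nat) : measurable_fun setT (walk_path n).
Proof.
apply: (@measurable_factor_nat _ _ n.+1) => w w' ww'.
apply/continuousEP => t; change (scaled_interp (walk ^~ w) n t = scaled_interp (walk ^~ w') n t).
rewrite /scaled_interp /interp; set k := Num.truncn _.
have kn : (k <= n)%N.
  rewrite truncn_le_nat.
  have /set_mem/= := valP t; rewrite in_itv/= => /andP[t0 t1].
  by rewrite (@le_lt_trans _ _ n%:R) ?ltr_nat// ler_piMr// ler0n.
have E i : (i <= n.+1)%N -> walk i w = walk i w'.
  by move=> in1; apply: eq_bigr => j _; rewrite ww'// (leq_trans _ in1).
by rewrite !E// ltnW.
Qed.

HB.instance Definition _ (n : nat) :=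
  isMeasurableFun.Build _ _ _ _ (walk_path n) (measurable_walk_path n).

(* The law of (n^{-1/2} S_{nt})_{t in [0,1]} given S_n = 0. *)
Definition bridge_law (n : nat) : probability (borel (C01 R)) R :=
  distribution (cond_prob P (measurable_walk0 n)) (walk_path n).

End walk.

(* Main.v *)
From HB Require Import structures.
Require Import Defs.
From mathcomp Require Import all_boot all_order all_algebra finmap.
From mathcomp Require Import all_classical all_reals all_analysis.
From mathcomp Require Import measurable_realfun.
From mathcomp Require Import complex zify ring lra.
Import Order.TTheory GRing.Theory Num.Theory.
Import numFieldNormedType.Exports.

Set Implicit Arguments.
Unset Strict Implicit.
Unset Printing Implicit Defensive.

Local Open Scope classical_set_scope.
Local Open Scope ring_scope.

(** Given S_n = 0, the first n Poisson variables are the occupation numbers of n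
    balls thrown independently and uniformly into n boxes. Writing E_n for the
    mean under this multinomial law, the multinomial theorem gives
    E_n (prod_j z_j ^ v_j) = ((z_1 + ... + z_n) / n) ^ n (lemma mexp_prod), and
    everything that concerns the walk is extracted from this identity. The
    passage from the conditional law to E_n is bridge_law_integral.

    The limit b is given, so the argument compares E_n F with the mean of F(b)
    for one functional F at a time, through three approximations.

    - A bounded continuous F is the increasing limit of its Lipschitz envelopes;
      applied to F and to - F, this reduces the claim to Lipschitz F
      (continuous_lower_limit, continuous_limit).

    - A Lipschitz F changes little when a path is replaced by the polygonal line
      through its values at the points i / m. For b this is uniform continuity
      of paths. For the walk it must hold uniformly in n: exponential moments
      bound the fourth moment of an increment over L steps by a multiple of
      L ^ 2, bisection upgrades this to a maximal inequality
      (maximal_fourth_moment), and the m blocks of n / m steps contribute a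
      total of order m (1 / m) ^ 2 (mexp_polygonal).

    - It remains to treat Lipschitz functions g of finitely many coordinates.
      Gaussian linear combinations of the coordinates of b are only known one
      at a time, through exp (a.x), whose means converge by an explicit
      computation (bridge_mgf_cvg against bridge_mgf). Exponentials are enough:
      g is within e (1 + |x| ^ 2) of a trigonometric polynomial
      (trig_approximation), and cos (a.x + phi) is within
      e (exp (3 a.x) + exp (- 3 a.x)) of a combination of exponentials of a.x
      (cos_exp_approx). These errors are unbounded in x, but their means are
      small, uniformly in n (fd_cvg_approx). *)

(** * Taylor estimates for exp, sin and cos *)

Section taylor.
Variable R : realType.
Implicit Types x y : R.

Lemma ge0_of_derive (f f' : R -> R) : f 0 = 0 ->
  (forall x, is_derive x 1 f (f' x)) -> (forall x, 0 <= x -> 0 <= f' x) ->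
  forall x, 0 <= x -> 0 <= f x.
Proof.
move=> f0 df f'0 x; rewrite le_eqVlt => /orP[/eqP <-|x0]; first by rewrite f0.
have [c cx] := @MVT_segment R f f' 0 x (ltW x0) (fun z _ => df z)
  (derivable_within_continuous (fun z _ => @ex_derive _ _ _ _ _ _ _ (df z))).
rewrite f0 !subr0 => ->; rewrite mulr_ge0 ?(ltW x0)// f'0//.
by move: cx; rewrite in_itv => /andP[].
Qed.

Lemma expRB1_le x : 0 <= x -> expR x - 1 <= x * expR x.
Proof.
move=> x0; have h := expR_ge1Dx (- x).
have := ler_wpM2l (expR_ge0 x) h; rewrite -expRD subrr expR0; lra.
Qed.

Lemma expRN_bounds x : 0 <= x -> 0 <= expR (- x) - 1 + x <= x ^+ 2.
Proof.
move=> x0; have h := expR_ge1Dx (- x); have h2 := expR_ge1Dx x.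
apply/andP; split; first lra.
have : expR (- x) <= (1 + x)^-1.
  by rewrite expRN lef_pV2 ?posrE ?expR_gt0//; lra.
have e : (1 + x)^-1 - 1 + x = x ^+ 2 / (1 + x) by field; lra.
have : x ^+ 2 / (1 + x) <= x ^+ 2.
  by rewrite ler_pdivrMr; [rewrite ler_peMr ?sqr_ge0|]; lra.
lra.
Qed.

Lemma expR_taylor1 x : `|expR x - 1 - x| <= x ^+ 2 * expR `|x|.
Proof.
have [x0|x0] := leP 0 x.
  rewrite (ger0_norm x0) ger0_norm; last by have := expR_ge1Dx x; lra.
  have h := expRB1_le x0.
  have := ler_wpM2l x0 h; lra.
have /expRN_bounds : 0 <= - x by lra.
rewrite opprK sqrrN => /andP[h1 h2].
rewrite (ltr0_norm x0) ger0_norm; last by lra.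
have e1 : 1 <= expR (- x) by have := expR_ge1Dx (- x); lra.
have : x ^+ 2 <= x ^+ 2 * expR (- x) by rewrite ler_peMr ?sqr_ge0.
lra.
Qed.

Lemma expR_taylor2 x :
  `|expR x - 1 - x - x ^+ 2 / 2| <= `|x| ^+ 3 * expR `|x|.
Proof.
have [x0|x0] := leP 0 x.
  have h1 : 0 <= expR x - 1 - x - x ^+ 2 / 2.
    apply: (@ge0_of_derive (fun x => expR x - 1 - x - x ^+ 2 / 2) (fun x => expR x - 1 - x)) => //.
    - by rewrite expR0; field.
    - move=> z; by apply: is_derive_eq; rewrite /GRing.scale/=; field.
    - by move=> z _; have := expR_ge1Dx z; lra.
  have h2 : 0 <= x ^+ 3 * expR x - (expR x - 1 - x - x ^+ 2 / 2).
    apply: (@ge0_of_derive (fun x => x ^+ 3 * expR x - (expR x - 1 - x - x ^+ 2 / 2))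
      (fun x => 3 * x ^+ 2 * expR x + x ^+ 3 * expR x - (expR x - 1 - x))) => //.
    - by rewrite expR0; field.
    - by move=> z; apply: is_derive_eq; rewrite /GRing.scale/=; field.
    - move=> z z0; have := expR_taylor1 z; rewrite (ger0_norm z0) => /ler_normlP[_ h].
      have e0 := expR_ge0 z.
      have : 0 <= z ^+ 2 * expR z by rewrite mulr_ge0 ?sqr_ge0.
      have : 0 <= z ^+ 3 * expR z by rewrite mulr_ge0 ?exprn_ge0.
      lra.
  by rewrite (ger0_norm x0) ger0_norm//; lra.
rewrite -[x]opprK; have {x0} : 0 <= - x by lra.
move: (- x) => {}x x0; rewrite normrN (ger0_norm x0) sqrrN.
have h1 : 0 <= - (expR (- x) - 1 + x - x ^+ 2 / 2).
  apply: (@ge0_of_derive (fun x => - (expR (- x) - 1 + x - x ^+ 2 / 2))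
      (fun x => expR (- x) - 1 + x)) => //.
  - by rewrite oppr0 expR0; field.
  - by move=> z; apply: is_derive_eq; rewrite /GRing.scale/=; field.
  - by move=> z /expRN_bounds/andP[].
have h2 : 0 <= x ^+ 3 + (expR (- x) - 1 + x - x ^+ 2 / 2).
  apply: (@ge0_of_derive (fun x => x ^+ 3 + (expR (- x) - 1 + x - x ^+ 2 / 2))
      (fun x => 3 * x ^+ 2 - (expR (- x) - 1 + x))) => //.
  - by rewrite oppr0 expR0; field.
  - by move=> z; apply: is_derive_eq; rewrite /GRing.scale/=; field.
  - by move=> z /expRN_bounds/andP[_ h]; have := sqr_ge0 z; lra.
have e1 : 1 <= expR x by have := expR_ge1Dx x; lra.
have : x ^+ 3 <= x ^+ 3 * expR x by rewrite ler_peMr ?exprn_ge0.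
by rewrite ler_norml => ?; apply/andP; split; lra.
Qed.

Lemma sin_bounds x : 0 <= x -> 0 <= x - sin x <= x ^+ 2.
Proof.
have h1 : forall x, 0 <= x -> 0 <= x - sin x.
  apply: (@ge0_of_derive (fun x => x - sin x) (fun x => 1 - cos x)).
  - by rewrite sin0 subrr.
  - by move=> z _; have := cos_le1 z; lra.
have h1' : forall x, 0 <= x -> 0 <= x + sin x.
  apply: (@ge0_of_derive (fun x => x + sin x) (fun x => 1 + cos x)).
  - by rewrite sin0 addr0.
  - by move=> z _; have := cos_geN1 z; lra.
move=> x0; rewrite h1//=.
have : 0 <= x ^+ 2 - (x - sin x); last by lra.
apply: (@ge0_of_derive (fun x => x ^+ 2 - (x - sin x)) (fun x => 2 * x - (1 - cos x))) => //.
- by rewrite sin0 expr0n/= !subrr.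
- by move=> z; apply: is_derive_eq; rewrite /GRing.scale/=; ring.
- move=> z z0.
  have -> : cos z = 1 - 2 * sin (z / 2) ^+ 2.
    have {1}-> : z = (z / 2) *+ 2 by rewrite -mulr_natr; field.
    by rewrite cos_mulr2n cos2sin2; ring.
  have := h1 (z / 2) ltac:(lra); have := h1' (z / 2) ltac:(lra).
  have := sin_le1 (z / 2); have := sin_geN1 (z / 2); nra.
Qed.

Lemma sin_taylor1 x : `|sin x - x| <= x ^+ 2.
Proof.
have [x0|x0] := leP 0 x.
  by have /andP[h1 h2] := sin_bounds x0; rewrite distrC ger0_norm.
have /sin_bounds/andP[] : 0 <= - x by lra.
by rewrite sinN sqrrN => h1 h2; rewrite ger0_norm; lra.
Qed.

Lemma cos_taylor1 x : `|cos x - 1| <= x ^+ 2.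
Proof.
have -> : cos x = 1 - 2 * sin (x / 2) ^+ 2.
  have {1}-> : x = (x / 2) *+ 2 by rewrite -mulr_natr; field.
  by rewrite cos_mulr2n cos2sin2; ring.
have h : sin (x / 2) ^+ 2 <= (x / 2) ^+ 2.
  wlog x0 : x / 0 <= x => [H|].
    have [/H//|x0] := leP 0 x; have := H (- x) ltac:(lra).
    by rewrite mulNr sinN !sqrrN.
  have [s0|s0] := leP 0 (sin (x / 2)).
    have /sin_bounds/andP[h1 _] : 0 <= x / 2 by lra.
    by rewrite lerXn2r ?nnegrE//; lra.
  have := sin_taylor1 (x / 2); have := sin_geN1 (x / 2) => h3 /ler_normlP[h4 h5].
  nra.
rewrite [X in `|X|](_ : _ = - (2 * sin (x / 2) ^+ 2)); last by ring.
rewrite normrN ger0_norm; last by rewrite mulr_ge0 ?sqr_ge0.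
have := sqr_ge0 x; move: h; rewrite expr_div_n; lra.
Qed.

End taylor.

(** * Approximation of the cosine by real exponentials *)

Section exponential_approximation.

Lemma ler_norm_subX (D : numDomainType) (z w B : D) N :
  1 <= B -> `|z| <= B -> `|w| <= B -> `|z ^+ N - w ^+ N| <= N%:R * `|z - w| * B ^+ N.
Proof.
move=> B1 zB wB; have B0 : 0 <= B by apply: le_trans B1.
elim: N => [|N IH]; first by rewrite !expr0 subrr normr0 !mul0r.
have -> : z ^+ N.+1 - w ^+ N.+1 = z * (z ^+ N - w ^+ N) + (z - w) * w ^+ N.
  by rewrite !exprS; ring.
apply: le_trans (ler_normD _ _) _; rewrite !normrM.
have h1 : `|z| * `|z ^+ N - w ^+ N| <= B * (N%:R * `|z - w| * B ^+ N) by apply: ler_pM.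
have h2 : `|z - w| * `|w ^+ N| <= `|z - w| * B ^+ N.+1.
  rewrite ler_wpM2l// normrX (@le_trans _ _ (B ^+ N))//.
    by rewrite lerXn2r ?nnegrE.
  by rewrite exprS ler_peMl// exprn_ge0.
apply: le_trans (lerD h1 h2) _.
by rewrite le_eqVlt -natr1 exprS; apply/orP; left; apply/eqP; ring.
Qed.

Variable R : realType.
Implicit Types (y u : R).
Local Notation toC := (real_complex R).

Lemma sqr_le_expR y : y ^+ 2 <= 4 * expR `|y|.
Proof.
have h : 0 <= `|y| / 2 by rewrite divr_ge0.
have := expR_ge1Dx (`|y| / 2).
have -> : expR `|y| = expR (`|y| / 2) ^+ 2 by rewrite -expRM_natl; congr expR; field.
rewrite -[y ^+ 2]real_normK ?num_real//; nra.
Qed.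

Lemma expR_norm_le (k y : R) : 0 <= k -> expR (k * `|y|) <= expR (k * y) + expR (- (k * y)).
Proof.
have h1 := expR_ge0 (k * y); have h2 := expR_ge0 (- (k * y)).
move=> _; have [y0|y0] := leP 0 y; first by rewrite (ger0_norm y0); lra.
by rewrite (ltr0_norm y0) mulrN; lra.
Qed.

Lemma ler_normcE (z : R[i]) (b : R) : `|z| <= toC b -> `|complex.Re z| <= b.
Proof. by move=> /(le_trans (normc_ge_Re z)); rewrite lecR. Qed.

Lemma norm_Complex_le (a b : R) : `|Complex a b| <= (toC (`|a| + `|b|)).
Proof.
rewrite normc_def lecR/= -[leRHS]ger0_norm ?addr_ge0// -sqrtr_sqr ler_wsqrtr//.
rewrite sqrrD !real_normK ?num_real// lerD2r lerDl mulrn_wge0// mulr_ge0//.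
Qed.

Lemma cexpX u N : (Complex (cos u) (sin u)) ^+ N = Complex (cos (N%:R * u)) (sin (N%:R * u)).
Proof.
elim: N => [|N IH]; first by rewrite mul0r cos0 sin0.
by rewrite exprS IH -natr1 mulrDl mul1r cosD sinD; simpc; congr Complex; ring.
Qed.

(** e^(iy) is close to (1 + i (e^(y/N) - 1))^N, which expands into real
    exponentials of y with complex coefficients, and cos (y + phi) is the real part
    of e^(i phi) e^(iy). As 1 + |e^u - 1| <= e^|u|, all partial powers stay below
    e^|y|; each of the N factors has an error of order (y/N)^2 e^|y|, so the
    total error is of order e^(3|y|) / N. *)
Lemma cos_exp_approx (phi e : R) : 0 < e -> exists s : seq (R * R), forall y,
  `|cos (y + phi) - \sum_(c <- s) c.1 * expR (c.2 * y)| <=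
  e * (expR (3 * y) + expR (- (3 * y))).
Proof.
move=> e0; pose N := (Num.truncn (12 / e)).+1.
have N0 : 0 < N%:R :> R by rewrite ltr0n.
have Ne : 12 / N%:R <= e.
  by rewrite ler_pdivrMr// mulrC -ler_pdivrMr// ltW// truncnS_gt.
pose w0 : R[i] := Complex (cos phi) (sin phi).
pose ic : R[i] := Complex 0 1.
pose coef (k : nat) : R[i] := w0 * ((1 - ic) ^+ (N - k) * ic ^+ k *+ 'C(N, k)).
exists [seq (complex.Re (coef k), k%:R / N%:R) | k <- iota 0 N.+1] => y.
pose u := y / N%:R.
have Nu : N%:R * u = y by rewrite /u mulrC divfK// gt_eqF.
pose z : R[i] := 1 + ic * (toC (expR u - 1)).
pose w : R[i] := Complex (cos u) (sin u).
have -> : \sum_(c <- [seq (complex.Re (coef k), k%:R / N%:R) | k <- iota 0 N.+1]) c.1 * expR (c.2 * y) =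
    complex.Re (w0 * z ^+ N).
  have -> : z = (1 - ic) + ic * (toC (expR u)) by rewrite /z rmorphB rmorph1; ring.
  rewrite big_map -[iota 0 N.+1]/(index_iota 0 N.+1) big_mkord exprDn big_distrr/= raddf_sum/=.
  apply: eq_bigr => k _; rewrite exprMn -rmorphXn/= -expRM_natl.
  have -> : (k%:R / N%:R) * y = k%:R * u by rewrite /u; field; lra.
  rewrite mulrA -mulrnAl [w0 * _]mulrA -/(coef k).
  by case: (coef k) => a b; simpc.
have -> : cos (y + phi) = complex.Re (w0 * w ^+ N).
  by rewrite cexpX Nu /w0; simpc; rewrite cosD /=; ring.
rewrite -raddfB -mulrBr/=; apply: ler_normcE; rewrite normrM.
have -> : `|w0| = 1 by rewrite normc_def/= cos2Dsin2 sqrtr1.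
rewrite mul1r distrC.
have B1 : 1 <= expR `|u| by rewrite -expR0 ler_expR.
have zB : `|z| <= (toC (expR `|u|)).
  apply: (@le_trans _ _ (toC (1 + `|expR u - 1|))).
    apply: le_trans (ler_normD _ _) _; rewrite normr1 (_ : toC (1 + _) = 1 + toC `|expR u - 1|) ?rmorphD// lerD2l normrM.
    have -> : `|ic| = 1 by rewrite normc_def/= expr0n expr1n add0r sqrtr1.
    by rewrite mul1r normc_def/= addr0 expr0n addr0 sqrtr_sqr.
  rewrite lecR; have [u0|u0] := leP 0 u.
    rewrite ger0_norm ?(ger0_norm u0); first by lra.
    by have := expR_ge1Dx u; lra.
  rewrite ltr0_norm ?(ltr0_norm u0); last by have := @expR_lt1 _ u; rewrite u0; lra.
  by have := expR_ge1Dx u; have := expR_ge1Dx (- u); lra.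
have wB : `|w| <= (toC (expR `|u|)).
  by rewrite normc_def/= cos2Dsin2 sqrtr1 lecR.
have B1' : 1 <= (toC (expR `|u|)) :> R[i] by rewrite -(rmorph1 (real_complex R)) lecR.
apply: le_trans (ler_norm_subX N B1' zB wB) _.
have zw : `|z - w| <= (toC (3 * u ^+ 2 * expR `|u|)).
  have -> : z - w = Complex (1 - cos u) (expR u - 1 - sin u) by rewrite /z; simpc.
  apply: le_trans (norm_Complex_le _ _) _; rewrite lecR.
  have h1 := cos_taylor1 u; rewrite distrC in h1.
  have h2 : `|expR u - 1 - sin u| <= u ^+ 2 * expR `|u| + u ^+ 2.
    rewrite (_ : _ - sin u = (expR u - 1 - u) - (sin u - u)); last by ring.
    by apply: le_trans (ler_normB _ _) _; rewrite lerD ?expR_taylor1 ?sin_taylor1.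
  have : u ^+ 2 <= u ^+ 2 * expR `|u| by rewrite ler_peMr ?sqr_ge0.
  lra.
apply: (@le_trans _ _ (N%:R * (toC (3 * u ^+ 2 * expR `|u|)) * (toC (expR `|u|)) ^+ N)).
  by rewrite ler_wpM2r ?exprn_ge0 ?(le_trans _ B1')// ler_wpM2l.
rewrite -(rmorph_nat (real_complex R)) -rmorphXn -!rmorphM lecR -expRM_natl.
have yu : N%:R * `|u| = `|y| by rewrite -[in RHS]Nu [RHS]normrM normr_nat.
rewrite yu.
have uy : expR `|u| <= expR `|y|.
  by rewrite ler_expR -yu ler_peMl// ler1n.
apply: (@le_trans _ _ (12 / N%:R * expR (3 * `|y|))); last first.
  apply: (@le_trans _ _ (e * expR (3 * `|y|))); first by rewrite ler_wpM2r ?expR_ge0.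
  by apply: ler_wpM2l; [exact: ltW|exact: expR_norm_le].
rewrite [leLHS](_ : _ = 3 / N%:R * (y ^+ 2 * (expR `|u| * expR `|y|))); last first.
  by rewrite /u; field; lra.
rewrite (_ : 12 / N%:R * _ = 3 / N%:R * (4 * expR `|y| * (expR `|y| * expR `|y|))); last first.
  have -> : expR (3 * `|y|) = expR `|y| ^+ 3 by rewrite -expRM_natl.
  by field; lra.
apply: ler_wpM2l; first by apply: divr_ge0; lra.
apply: ler_pM; rewrite ?sqr_ge0 ?mulr_ge0 ?expR_ge0 ?sqr_le_expR//.
by apply: ler_wpM2r => //; exact: expR_ge0.
Qed.

End exponential_approximation.

(** * Approximation of Lipschitz functions by trigonometric polynomials *)

Section bernstein.
Variable R : realType.
Implicit Types s a : R.

(** The binomial probabilities C(N,k) s^k (1-s)^(N-k), defined by Pascal's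
    recursion: sums against them are then computed by induction on N. *)
Fixpoint bern (N : nat) (k : nat) s : R :=
  if N is N'.+1 then
    (1 - s) * bern N' k s + s * (if k is k'.+1 then bern N' k' s else 0)
  else (k == 0%N)%:R.

Lemma bern_ge0 N k s : 0 <= s <= 1 -> 0 <= bern N k s.
Proof.
move=> /andP[s0 s1]; elim: N k => [|N IH] k /=; first by case: eqP.
by rewrite addr_ge0// mulr_ge0 ?subr_ge0//; case: k.
Qed.

Lemma bern_small N k s : (N < k)%N -> bern N k s = 0.
Proof.
elim: N k => [|N IH] [|k]//= Nk; rewrite !IH ?mulr0 ?addr0//.
by rewrite ltnW.
Qed.

Lemma sum_bernS N s (h : nat -> R) :
  \sum_(k < N.+2) bern N.+1 k s * h k =
  (1 - s) * (\sum_(k < N.+1) bern N k s * h k) + s * (\sum_(k < N.+1) bern N k s * h k.+1).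
Proof.
under eq_bigr do rewrite /= mulrDl -!mulrA.
rewrite big_split/= -!big_distrr/=; congr (_ * _ + _ * _).
  by rewrite big_ord_recr/= bern_small// mul0r addr0.
by rewrite big_ord_recl/= mul0r add0r.
Qed.

Lemma sum_bern N s : \sum_(k < N.+1) bern N k s = 1.
Proof.
elim: N => [|N IH]; first by rewrite big_ord1.
have := sum_bernS N s (fun=> 1).
under eq_bigr do rewrite mulr1.
by under [in RHS]eq_bigr do rewrite mulr1; rewrite IH => ->; ring.
Qed.

(** The centre is arbitrary because the recursion shifts it. *)
Lemma bern_variance N s a :
  \sum_(k < N.+1) bern N k s * (k%:R - a) ^+ 2 = N%:R * s * (1 - s) + (N%:R * s - a) ^+ 2.
Proof.
elim: N a => [|N IH] a; first by rewrite big_ord1 /=; ring.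
rewrite (sum_bernS N s (fun k => (k%:R - a) ^+ 2)) IH.
have -> : \sum_(k < N.+1) bern N k s * (k.+1%:R - a) ^+ 2 =
          \sum_(k < N.+1) bern N k s * (k%:R - (a - 1)) ^+ 2.
  by apply: eq_bigr => k _; rewrite -natr1; congr (_ * _ ^+ 2); ring.
by rewrite IH -natr1; ring.
Qed.

(** Integrate |x| <= e + x^2 / e against the weights, using their variance. *)
Lemma bern_abs N s (e : R) : (0 < N)%N -> 0 < e -> 0 <= s <= 1 -> (N%:R * e ^+ 2)^-1 <= 1 ->
  \sum_(k < N.+1) bern N k s * `|k%:R / N%:R - s| <= 2 * e.
Proof.
move=> N0 e0 s01 Ne; have N0' : 0 < N%:R :> R by rewrite ltr0n.
have b k : bern N k s * `|k%:R / N%:R - s| <=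
    bern N k s * e + (N%:R ^+ 2 * e)^-1 * (bern N k s * (k%:R - N%:R * s) ^+ 2).
  rewrite mulrCA -mulrDr ler_wpM2l ?bern_ge0//.
  have -> : (k%:R - N%:R * s) ^+ 2 = N%:R ^+ 2 * `|k%:R / N%:R - s| ^+ 2.
    by rewrite real_normK ?num_real//; field; lra.
  set x := `|_|; have x0 : 0 <= x := normr_ge0 _.
  rewrite [X in _ <= _ + X](_ : _ = x ^+ 2 / e); last by field; lra.
  have -> : e + x ^+ 2 / e = x + ((x - e / 2) ^+ 2 + 3 / 4 * e ^+ 2) / e by field; lra.
  rewrite lerDl; apply: divr_ge0; last exact: ltW.
  by have := sqr_ge0 (x - e / 2); have := sqr_ge0 e; lra.
apply: le_trans (ler_sum _ (fun (k : 'I_N.+1) _ => b k)) _.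
rewrite big_split/= -big_distrl/= -big_distrr/= sum_bern bern_variance mul1r.
rewrite [leLHS](_ : _ = e + e * (s * (1 - s) * (N%:R * e ^+ 2)^-1)); last by field; lra.
have : s * (1 - s) * (N%:R * e ^+ 2)^-1 <= 1.
  move/andP: s01 => [s0 s1].
  apply: mulr_ile1 => //; [nra| |nra].
  by rewrite invr_ge0 mulr_ge0 ?sqr_ge0.
nra.
Qed.

End bernstein.

Section trigonometric_polynomials.
Variables (R : realType) (m : nat).
Implicit Types (p q : ('I_m -> R) -> R).

(** Phases account for the sines, and make the span of these functions visibly
    closed under products. *)
Definition trig_poly p := exists s : seq (R * ('I_m -> R) * R), forall x,
  p x = \sum_(c <- s) c.1.1 * cos (\sum_i c.1.2 i * x i + c.2).

Lemma trig_poly_cst c : trig_poly (fun=> c).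
Proof.
exists [:: (c, (fun=> 0), 0)] => x; rewrite big_seq1/= big1 ?addr0 ?cos0 ?mulr1//.
by move=> i _; rewrite mul0r.
Qed.

Lemma trig_polyD p q : trig_poly p -> trig_poly q -> trig_poly (fun x => p x + q x).
Proof. by move=> [s ps] [r qr]; exists (s ++ r) => x; rewrite ps qr big_cat. Qed.

Lemma trig_polyM p q : trig_poly p -> trig_poly q -> trig_poly (fun x => p x * q x).
Proof.
move=> [s ps] [r qr].
exists (flatten [seq [seq (c.1.1 * d.1.1 / 2, (fun i => c.1.2 i + d.1.2 i), c.2 + d.2) | d <- r] ++
     [seq (c.1.1 * d.1.1 / 2, (fun i => c.1.2 i - d.1.2 i), c.2 - d.2) | d <- r] | c <- s]) => x.
rewrite ps qr big_distrl/= big_flatten/= big_map. apply: eq_bigr => c _.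
rewrite big_cat/= !big_map/= big_distrr -big_split/=; apply: eq_bigr => d _.
set a := \sum_i _ + c.2; set b := \sum_i _ + d.2.
have -> : \sum_i (c.1.2 i + d.1.2 i) * x i + (c.2 + d.2) = a + b.
  rewrite /a /b addrACA -big_split/=; congr (_ + _).
  by apply: eq_bigr => i _; rewrite mulrDl.
have -> : \sum_i (c.1.2 i - d.1.2 i) * x i + (c.2 - d.2) = a - b.
  rewrite /a /b opprD addrACA -sumrB/=; congr (_ + _).
  by apply: eq_bigr => i _; rewrite mulrBl.
by rewrite (cosD a) (cosB a); field.
Qed.

Lemma trig_poly_sum (I : Type) (r : seq I) (p : I -> ('I_m -> R) -> R) :
  (forall i, trig_poly (p i)) -> trig_poly (fun x => \sum_(i <- r) p i x).
Proof.
move=> pt; elim: r => [|i r IH].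
  by under eq_fun do rewrite big_nil; exact: trig_poly_cst.
by under eq_fun do rewrite big_cons; exact: trig_polyD.
Qed.

Lemma trig_poly_prod (I : Type) (r : seq I) (p : I -> ('I_m -> R) -> R) :
  (forall i, trig_poly (p i)) -> trig_poly (fun x => \prod_(i <- r) p i x).
Proof.
move=> pt; elim: r => [|i r IH].
  by under eq_fun do rewrite big_nil; exact: trig_poly_cst.
by under eq_fun do rewrite big_cons; exact: trig_polyM.
Qed.

Lemma trig_poly_sin (i : 'I_m) (k : R) : trig_poly (fun x => sin (x i / k)).
Proof.
exists [:: (1, (fun j => if j == i then k^-1 else 0), - (pi / 2))] => x.
rewrite big_seq1/= mul1r -cosBpihalf; congr (cos (_ - _)).
rewrite (bigD1 i)//= eqxx big1 ?addr0 1?mulrC// => j /negbTE ->.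
by rewrite mul0r.
Qed.

Lemma trig_poly_bern p N k : trig_poly p -> trig_poly (fun x => bern N k (p x)).
Proof.
move=> pt; elim: N k => [|N IH] k /=; first exact: trig_poly_cst.
apply: trig_polyD; apply: trig_polyM => //.
- apply: trig_polyD; first exact: trig_poly_cst.
  have -> : (fun x => - p x) = (fun x => -1 * p x) by apply/funext => x; rewrite mulN1r.
  by apply: trig_polyM => //; exact: trig_poly_cst.
- by case: k => [|k]; [exact: trig_poly_cst|exact: IH].
Qed.

(** First replace x_i by kap sin (x_i / kap), at the cost of x_i^2 / kap. The
    argument of g is now an affine image of the point of [0, 1]^m with coordinates
    s_i = (1 + sin (x_i / kap)) / 2, where g is approximated uniformly by its
    Bernstein polynomial, a trigonometric polynomial in x. Sines being bounded on
    the whole line, the estimate holds for all x at once. *)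
Lemma trig_approximation (g : ('I_m -> R) -> R) (L e : R) :
  (forall x y, `|g x - g y| <= L * \sum_i `|x i - y i|) -> 0 <= L -> 0 < e ->
  exists2 p, trig_poly p & forall x, `|g x - p x| <= e * (1 + \sum_i x i ^+ 2).
Proof.
move=> gL L0 e0.
(* kap makes the first error at most e times the sum of the x_i^2; the Bernstein
   error is at most 4 kap eta in each coordinate, and eta makes it e in total *)
pose kap : R := (L + 1) / e.
have k0 : 0 < kap by apply: divr_gt0 => //; lra.
have kapE : kap = (L + 1) / e by []; clearbody kap.
pose eta : R := e / ((L * m%:R + 1) * (4 * kap)).
have Lm : 0 <= L * m%:R by rewrite mulr_ge0.
have eta0 : 0 < eta by apply: divr_gt0 => //; apply: mulr_gt0; lra.
have etaE : eta = e / ((L * m%:R + 1) * (4 * kap)) by []; clearbody eta.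
pose N := (Num.truncn ((eta ^+ 2)^-1)).+1.
have N0 : (0 < N)%N by [].
have Neta : (N%:R * eta ^+ 2)^-1 <= 1.
  rewrite invf_le1 ?mulr_gt0 ?exprn_gt0 ?ltr0n//.
  by rewrite -ler_pdivrMr ?exprn_gt0// div1r ltW// truncnS_gt.
clearbody N; have Nr0 : 0 < N%:R :> R by rewrite ltr0n.
pose s (u : R) := (1 + sin (u / kap)) / 2.
have s01 u : 0 <= s u <= 1.
  by have := sin_le1 (u / kap); have := sin_geN1 (u / kap); rewrite /s => *; apply/andP; split; lra.
pose node (k : nat) : R := kap * (2 * (k%:R / N%:R) - 1).
pose p (x : 'I_m -> R) := \sum_(k : {ffun 'I_m -> 'I_N.+1})
  g (fun i => node (k i)) * \prod_i bern N (k i) (s (x i)).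
exists p.
  apply: trig_poly_sum => k; apply: trig_polyM; first exact: trig_poly_cst.
  apply: trig_poly_prod => i; apply: trig_poly_bern; apply: trig_polyM; last exact: trig_poly_cst.
  by apply: trig_polyD; [exact: trig_poly_cst|exact: trig_poly_sin].
move=> x.
pose w (k : {ffun 'I_m -> 'I_N.+1}) := \prod_i bern N (k i) (s (x i)).
have w0 k : 0 <= w k by apply: prodr_ge0 => i _; apply: bern_ge0.
have w1 : \sum_k w k = 1.
  rewrite -(bigA_distr_bigA (fun i (k : 'I_N.+1) => bern N k (s (x i)))).
  by rewrite big1// => i _; rewrite sum_bern.
have -> : g x - p x = \sum_k w k * (g x - g (fun i => node (k i))).
  under [RHS]eq_bigr do rewrite mulrBr.
  rewrite big_split/= -big_distrl/= w1 mul1r sumrN; congr (_ - _).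
  by apply: eq_bigr => k _; rewrite mulrC.
apply: le_trans (ler_norm_sum _ _ _) _.
apply: (@le_trans _ _ (\sum_k w k * (L * \sum_i `|x i - node (k i)|))).
  by apply: ler_sum => k _; rewrite normrM ger0_norm// ler_wpM2l.
under eq_bigr do rewrite mulrCA; rewrite -big_distrr/=.
under eq_bigr do rewrite big_distrr/=.
rewrite exchange_big/=.
(* summing out the coordinates other than j *)
have marg j : \sum_k w k * `|x j - node (k j)| =
    \sum_(k < N.+1) bern N k (s (x j)) * `|x j - node k|.
  pose F i (k : 'I_N.+1) := bern N k (s (x i)) * (if i == j then `|x j - node k| else 1).
  transitivity (\sum_(k : {ffun 'I_m -> 'I_N.+1}) \prod_i F i (k i)).
    apply: eq_bigr => k _; rewrite /F big_split/=; congr (_ * _).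
    rewrite (bigD1 j)//= eqxx big1 ?mulr1// => i /negbTE ->//.
  rewrite -bigA_distr_bigA (bigD1 j)//= [X in _ * X]big1 ?mulr1 => [|i /negbTE ij].
    by apply: eq_bigr => k _; rewrite /F eqxx.
  by rewrite -(sum_bern N (s (x i))); apply: eq_bigr => k _; rewrite /F ij mulr1.
have mj j : \sum_k w k * `|x j - node (k j)| <= x j ^+ 2 / kap + 2 * kap * (2 * eta).
  rewrite marg; apply: (@le_trans _ _ (\sum_(k < N.+1) (bern N k (s (x j)) * (x j ^+ 2 / kap) +
      2 * kap * (bern N k (s (x j)) * `|k%:R / N%:R - s (x j)|)))).
    apply: ler_sum => k _; rewrite [X in _ <= _ + X]mulrCA -mulrDr ler_wpM2l ?bern_ge0//.
    have -> : x j - node k = kap * (x j / kap - sin (x j / kap)) +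
        2 * kap * (s (x j) - k%:R / N%:R).
      by rewrite /node /s; field; lra.
    apply: le_trans (ler_normD _ _) _; rewrite !normrM (gtr0_norm k0) normr_nat (distrC (s (x j))).
    rewrite lerD2r; apply: (@le_trans _ _ (kap * (x j / kap) ^+ 2)).
      by apply: ler_wpM2l; [exact: ltW|rewrite distrC; exact: sin_taylor1].
    by rewrite le_eqVlt; apply/orP; left; apply/eqP; field; lra.
  rewrite big_split/= -big_distrl/= -big_distrr/= sum_bern mul1r lerD2l.
  by rewrite ler_wpM2l ?bern_abs// mulr_ge0// ltW.
apply: (@le_trans _ _ (L * \sum_j (x j ^+ 2 / kap + 2 * kap * (2 * eta)))).
  by rewrite ler_wpM2l//; apply: ler_sum => j _.
rewrite big_split/= -big_distrl/= sumr_const card_ord -[_ *+ m]mulr_natr.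
set Q := \sum_i _; have Q0 : 0 <= Q by apply: sumr_ge0 => i _; rewrite sqr_ge0.
rewrite mulrDr [e * _]mulrDr mulr1 addrC lerD//.
  rewrite [leLHS](_ : _ = e * (L * m%:R / (L * m%:R + 1))).
    by apply: ler_piMr; [exact: ltW|rewrite ler_pdivrMr; lra].
  by rewrite etaE; field; lra.
rewrite [leLHS](_ : _ = (e * Q) * (L / (L + 1))).
  by apply: ler_piMr; [rewrite mulr_ge0// ltW|rewrite ler_pdivrMr; lra].
by rewrite kapE; field; lra.
Qed.

End trigonometric_polynomials.

(** * Expectations and moment generating functions of Gaussian variables *)

Section expectation.
Context d (T : measurableType d) (R : realType) (P : probability T R).
Implicit Types h g : T -> R.

Definition integr h := P.-integrable setT (EFin \o h).

Lemma integr_cst c : integr (fun=> c).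
Proof. exact: finite_measure_integrable_cst. Qed.

Lemma integrD h g : integr h -> integr g -> integr (fun w => h w + g w).
Proof. by move=> ih ig; have := integrableD measurableT ih ig. Qed.

Lemma integrZ c h : integr h -> integr (fun w => c * h w).
Proof. by move=> ih; have := integrableZl measurableT c ih. Qed.

Lemma integrB h g : integr h -> integr g -> integr (fun w => h w - g w).
Proof.
move=> ih ig; under eq_fun do rewrite -mulN1r.
by apply: integrD => //; exact: integrZ.
Qed.

Lemma integr_sum (I : Type) (r : seq I) (h : I -> T -> R) :
  (forall i, integr (h i)) -> integr (fun w => \sum_(i <- r) h i w).
Proof.
move=> ih; elim: r => [|i r IH].
  by under eq_fun do rewrite big_nil; exact: integr_cst.
by under eq_fun do rewrite big_cons; exact: integrD.
Qed.

Lemma integr_dom h g : measurable_fun setT h -> (forall w, `|h w| <= g w) ->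
  integr g -> integr h.
Proof.
move=> mh hg; apply: le_integrable => //; first exact/measurable_EFinP.
by move=> w _; rewrite /= lee_fin (le_trans (hg w))// ler_norm.
Qed.

Lemma integr_bounded h M : measurable_fun setT h -> (forall w, `|h w| <= M) -> integr h.
Proof. by move=> mh hM; apply: integr_dom hM (integr_cst M). Qed.

Lemma RintegralT_cst c : \int[P]_w c = c :> R.
Proof. by rewrite Rintegral_cst//= probability_setT mulr1. Qed.

Lemma Rintegral_sumT (I : Type) (r : seq I) (h : I -> T -> R) :
  (forall i, integr (h i)) ->
  \int[P]_w (\sum_(i <- r) h i w) = \sum_(i <- r) \int[P]_w h i w.
Proof.
move=> ih; elim: r => [|i r IH].
  by rewrite big_nil; under eq_Rintegral do rewrite big_nil; exact: RintegralT_cst.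
rewrite big_cons -IH; under eq_Rintegral do rewrite big_cons.
rewrite RintegralD//; [exact: ih|exact: (integr_sum r ih)].
Qed.

Lemma le_Rintegral_norm h g : integr h -> integr g -> (forall w, `|h w| <= g w) ->
  `|\int[P]_w h w| <= \int[P]_w g w.
Proof.
move=> ih ig hg; apply: le_trans (le_normr_Rintegral _ ih) _ => //.
by apply: le_Rintegral => //; exact: integrable_norm.
Qed.

End expectation.

Section normal_law.
Variable R : realType.
Local Notation mu := (@lebesgue_measure R).

Lemma ge0_integral_normal_prob (m s : R) (f : R -> \bar R) : s != 0 ->
  measurable_fun setT f -> (forall x, (0 <= f x)%E) ->
  (\int[normal_prob m s]_x f x = \int[mu]_x (f x * (normal_pdf m s x)%:E))%E.
Proof.
move=> s0 mf f0; have dom := @normal_prob_dominates R m s.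
rewrite -(Radon_Nikodym_SigmaFinite.change_of_variables dom f0)//.
have rn_int := Radon_Nikodym_SigmaFinite.f_integrable dom.
apply: ae_eq_integral => //.
- by apply: emeasurable_funM => //; exact: (measurable_int mu).
- apply: emeasurable_funM => //; apply/measurable_EFinP; exact: measurable_normal_pdf.
- apply: ae_eqe_mul2l => /=; apply: integral_ae_eq => //.
  + by apply/measurable_EFinP; exact: measurable_normal_pdf.
  + by move=> E E01 mE; rewrite -(Radon_Nikodym_SigmaFinite.f_integral dom).
Qed.

(** Completing the square: multiplying the density with parameters m, s by
    exp (eta x) gives a multiple of the density with parameters m + eta s^2, s. *)
Lemma normal_mgf (m s eta : R) : s != 0 ->
  (\int[normal_prob m s]_x (expR (eta * x))%:E =
   (expR (eta * m + eta ^+ 2 * s ^+ 2 / 2))%:E)%E.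
Proof.
move=> s0.
have mexp : measurable_fun setT (fun x : R => expR (eta * x)).
  by apply: measurableT_comp => //; exact: measurable_funM.
have exp0 (x : R) : (0 <= (expR (eta * x))%:E)%E by rewrite lee_fin expR_ge0.
rewrite (ge0_integral_normal_prob _ s0 _ exp0); last exact/measurable_EFinP.
set c := expR _.
transitivity (\int[mu]_x (c%:E * (normal_pdf (m + eta * s ^+ 2) s x)%:E))%E.
  apply: eq_integral => x _; rewrite -!EFinM; congr EFin.
  rewrite !normal_pdfE// /normal_fun mulrCA [RHS]mulrCA; congr (_ * _).
  rewrite /c -!expRD; congr expR.
  have -> : s ^+ 2 *+ 2 = 2 * s ^+ 2 by rewrite mulr2n; ring.
  by field.
rewrite ge0_integralZl//.
- by rewrite integral_normal_pdf mule1.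
- by apply/measurable_EFinP; exact: measurable_normal_pdf.
- by move=> x _; rewrite lee_fin normal_pdf_ge0.
- by rewrite lee_fin expR_ge0.
Qed.

Context d (T : measurableType d) (P : probability T R).

Lemma is_gaussian_mgf (X : T -> R) : measurable_fun setT X -> is_gaussian P X ->
  exists m s : R, forall eta,
   (\int[P]_w (expR (eta * X w))%:E = (expR (eta * m + eta ^+ 2 * s ^+ 2 / 2))%:E)%E.
Proof.
move=> mX [m [s law]]; exists m, s => eta.
have mexp : measurable_fun setT (fun x : R => (expR (eta * x))%:E).
  apply/measurable_EFinP.
  by apply: measurableT_comp => //; exact: measurable_funM.
pose mX_ := isMeasurableFun.Build _ _ _ (measurableTypeR R) X mX.
pose X' : {RV P >-> measurableTypeR R} := HB.pack (X : T -> measurableTypeR R) mX_.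
transitivity (\int[distribution P X']_x (expR (eta * x))%:E)%E.
  by rewrite ge0_integral_distribution// => x; rewrite lee_fin expR_ge0.
have [s0|s0] := eqVneq s 0.
  transitivity (\int[\d_(m : measurableTypeR R)]_x (expR (eta * x))%:E)%E.
    apply: eq_measure_integral => A mA _; have := law A mA.
    by rewrite /gaussian_prob s0 eqxx.
  by rewrite integral_dirac// diracE in_setT mul1e s0 expr0n/= mulr0 mul0r addr0.
rewrite -normal_mgf//; apply: eq_measure_integral => A mA _.
by have := law A mA; rewrite /gaussian_prob (negbTE s0).
Qed.

Section centered_gaussian.
Variables (X : T -> R) (m s : R).
Hypothesis mX : measurable_fun setT X.
Hypothesis mgf : forall eta,
   (\int[P]_w (expR (eta * X w))%:E = (expR (eta * m + eta ^+ 2 * s ^+ 2 / 2))%:E)%E.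

Lemma mgf_measurable eta : measurable_fun setT (fun w => expR (eta * X w)).
Proof. by apply: measurableT_comp => //; exact: measurable_funM. Qed.

Lemma mgf_integr eta : integr P (fun w => expR (eta * X w)).
Proof.
apply/integrableP; split; first by apply/measurable_EFinP; exact: mgf_measurable.
under eq_integral do rewrite /= ger0_norm ?expR_ge0//.
by rewrite mgf ltry.
Qed.

Lemma mgf_Rintegral eta :
  \int[P]_w expR (eta * X w) = expR (eta * m + eta ^+ 2 * s ^+ 2 / 2).
Proof. by rewrite /Rintegral mgf. Qed.

Lemma mgf_integr_dom (h : T -> R) C k : measurable_fun setT h -> 0 <= C -> 0 <= k ->
  (forall w, `|h w| <= C * expR (k * `|X w|)) -> integr P h.
Proof.
move=> mh C0 k0 hb.
apply: (@integr_dom _ _ _ _ _ (fun w => C * (expR (k * X w) + expR ((- k) * X w)))) => //.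
  move=> w; apply: le_trans (hb w) _; rewrite ler_wpM2l// mulNr.
  exact: expR_norm_le.
by apply: integrZ; apply: integrD; exact: mgf_integr.
Qed.

Lemma mgf_integr_X : integr P X.
Proof.
apply: (@mgf_integr_dom _ 1 1) => // w; rewrite !mul1r.
by have := expR_ge1Dx `|X w|; lra.
Qed.

Lemma mgf_integr_X2 : integr P (fun w => X w ^+ 2).
Proof.
apply: (@mgf_integr_dom _ 4 1) => // [|w]; first exact: measurable_funX.
by rewrite mul1r ger0_norm ?sqr_ge0// sqr_le_expR.
Qed.

(** By 1 + y <= e^y, a centered variable has a generating function at least 1, so
    eta m + eta^2 s^2 / 2 >= 0 for every eta, of either sign. *)
Lemma mgf_mean : \int[P]_w X w = 0 -> m = 0.
Proof.
move=> EX.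
have J eta : 0 <= eta * m + eta ^+ 2 * s ^+ 2 / 2.
  rewrite -ler_expR expR0 -mgf_Rintegral.
  have -> : 1 = \int[P]_w (1 + eta * X w).
    rewrite RintegralD//; [|exact: integr_cst|exact/integrZ/mgf_integr_X].
    by rewrite RintegralT_cst RintegralZl ?EX ?mulr0 ?addr0//; exact: mgf_integr_X.
  apply: le_Rintegral => //; last by move=> w _; exact: expR_ge1Dx.
    by apply: integrD; [exact: integr_cst|exact/integrZ/mgf_integr_X].
  exact: mgf_integr.
have s2 := sqr_ge0 s.
(* at eta = - m / (s ^ 2 + 1) the exponent is negative unless m = 0 *)
have := J (- m / (s ^+ 2 + 1)).
have -> : - m / (s ^+ 2 + 1) * m + (- m / (s ^+ 2 + 1)) ^+ 2 * s ^+ 2 / 2 =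
    - (m ^+ 2 * ((s ^+ 2 / 2 + 1) / (s ^+ 2 + 1) ^+ 2)).
  by field; lra.
rewrite oppr_ge0 pmulr_lle0; last by rewrite divr_gt0 ?exprn_gt0//; lra.
by move=> m2; apply/eqP; rewrite -sqrf_eq0 eq_le m2 sqr_ge0.
Qed.

(** Two expansions of the generating function at order 2 in eta: one under the
    integral sign, with remainder eta^3 A, the other from its closed form. Dividing
    their difference by eta^2 and letting eta tend to 0 identifies s^2 and v. *)
Lemma mgf_variance v : \int[P]_w X w = 0 -> \int[P]_w (X w ^+ 2) = v -> s ^+ 2 = v.
Proof.
move=> EX EX2; have m0 := mgf_mean EX.
pose Y w := `|X w| ^+ 3 * expR `|X w|.
have iY : integr P Y.
  apply: (@mgf_integr_dom _ 4 3) => // [|w].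
    apply: measurable_funM.
      by apply: measurable_funX; exact: measurableT_comp.
    by apply: measurableT_comp => //; exact: measurableT_comp.
  rewrite ger0_norm ?mulr_ge0 ?exprn_ge0 ?expR_ge0//.
  have -> : expR (3 * `|X w|) = expR `|X w| ^+ 3 by rewrite -expRM_natl.
  have h1 := sqr_le_expR (X w); rewrite -real_normK ?num_real// in h1.
  have h2 : `|X w| <= expR `|X w| by have := expR_ge1Dx `|X w|; lra.
  have := ler_pM (normr_ge0 (X w)) (sqr_ge0 `|X w|) h2 h1; have e0 := expR_ge0 `|X w|.
  move/(fun h => ler_wpM2r e0 h) => h3; rewrite /Y; lra.
pose A := \int[P]_w Y w.
have A0 : 0 <= A by apply: Rintegral_ge0 => w _; rewrite mulr_ge0 ?exprn_ge0 ?expR_ge0.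
pose q := s ^+ 2 / 2.
have q0 : 0 <= q by rewrite divr_ge0 ?sqr_ge0.
have key eta : 0 < eta <= 1 -> `|q - v / 2| <= eta * (A + q ^+ 2 * expR q).
  move=> /andP[e0 e1].
  have E1 : `|expR (eta ^+ 2 * q) - 1 - eta ^+ 2 * (v / 2)| <= eta ^+ 3 * A.
    have -> : expR (eta ^+ 2 * q) = \int[P]_w expR (eta * X w).
      by rewrite mgf_Rintegral m0 mulr0 add0r /q mulrA.
    have -> : \int[P]_w expR (eta * X w) - 1 - eta ^+ 2 * (v / 2) =
        \int[P]_w (expR (eta * X w) - (1 + (eta * X w + (eta ^+ 2 / 2) * X w ^+ 2))).
      have i1 := integrZ eta mgf_integr_X; have i2 := integrZ (eta ^+ 2 / 2) mgf_integr_X2.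
      rewrite RintegralB//; [|exact: mgf_integr|by apply: integrD; [exact: integr_cst|exact: integrD]].
      rewrite RintegralD//; [|exact: integr_cst|exact: integrD].
      rewrite RintegralD// RintegralT_cst RintegralZl//; last exact: mgf_integr_X.
      rewrite RintegralZl//; last exact: mgf_integr_X2.
      by rewrite EX EX2; field.
    have -> : eta ^+ 3 * A = \int[P]_w (eta ^+ 3 * Y w) by rewrite RintegralZl.
    apply: le_Rintegral_norm.
    - apply: integrB; first exact: mgf_integr.
      apply: integrD; first exact: integr_cst.
      by apply: integrD; apply: integrZ; [exact: mgf_integr_X|exact: mgf_integr_X2].
    - exact: integrZ.
    - move=> w; have := expR_taylor2 (eta * X w).
      rewrite normrM (gtr0_norm e0).
      have -> : expR (eta * X w) - 1 - eta * X w - (eta * X w) ^+ 2 / 2 =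
        expR (eta * X w) - (1 + (eta * X w + eta ^+ 2 / 2 * X w ^+ 2)) by field.
      move=> /le_trans; apply; rewrite exprMn -mulrA /Y ler_wpM2l ?exprn_ge0 ?(ltW e0)//.
      by rewrite ler_wpM2l ?exprn_ge0// ler_expR ler_piMl.
  have E2 : `|expR (eta ^+ 2 * q) - 1 - eta ^+ 2 * q| <= eta ^+ 3 * (q ^+ 2 * expR q).
    have e2q : 0 <= eta ^+ 2 * q by rewrite mulr_ge0 ?sqr_ge0.
    apply: le_trans (expR_taylor1 _) _; rewrite (ger0_norm e2q).
    have -> : (eta ^+ 2 * q) ^+ 2 = eta ^+ 3 * (eta * q ^+ 2) by ring.
    rewrite -mulrA; apply: ler_wpM2l; first by rewrite exprn_ge0// ltW.
    have p0 : 0 <= q ^+ 2 * expR q by rewrite mulr_ge0 ?sqr_ge0 ?expR_ge0.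
    apply: (@le_trans _ _ (eta * (q ^+ 2 * expR q))); last by rewrite ler_piMl.
    rewrite -mulrA; apply: ler_wpM2l; first exact: ltW.
    apply: ler_wpM2l; first exact: sqr_ge0.
    by rewrite ler_expR ler_piMl// exprn_ile1// ltW.
  rewrite -(@ler_pM2l _ (eta ^+ 2)) ?exprn_gt0//.
  have -> : eta ^+ 2 * `|q - v / 2| = `|eta ^+ 2 * (q - v / 2)|.
    by rewrite normrM (ger0_norm (sqr_ge0 _)).
  have -> : eta ^+ 2 * (q - v / 2) = (expR (eta ^+ 2 * q) - 1 - eta ^+ 2 * (v / 2)) -
     (expR (eta ^+ 2 * q) - 1 - eta ^+ 2 * q) by ring.
  apply: le_trans (ler_normB _ _) _.
  rewrite [leRHS](_ : _ = eta ^+ 3 * A + eta ^+ 3 * (q ^+ 2 * expR q)); last by ring.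
  exact: lerD.
set B := A + _ in key.
have B0 : 0 <= B by rewrite addr_ge0// mulr_ge0 ?sqr_ge0 ?expR_ge0.
suff : `|q - v / 2| <= 0 by rewrite normr_le0 subr_eq0 /q => /eqP; lra.
apply/ler_addgt0Pl => e e0; rewrite addr0.
pose eta := Num.min 1 (e / (B + 1)).
have eta0 : 0 < eta by rewrite lt_min ltr01 divr_gt0//; lra.
have eta1 : eta <= 1 by rewrite ge_min lexx.
have h : eta <= e / (B + 1) by rewrite ge_min lexx orbT.
apply: le_trans (key eta _) _; first by rewrite eta0.
apply: (@le_trans _ _ (e / (B + 1) * B)); first by rewrite ler_wpM2r.
by rewrite mulrAC ler_pdivrMr; nra.
Qed.

End centered_gaussian.
End normal_law.

(** * The multinomial law *)

Section truncated_exponential.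
Variable F : numFieldType.

Definition exp_poly (n : nat) (a : F) : {poly F} :=
  \poly_(k < n.+1) (a ^+ k / k`!%:R).

(** Agreement with the series of exp (aX) up to degree n, which products preserve
    although the truncated series are not themselves multiplicative in a. *)
Definition exp_coefs (n : nat) (p : {poly F}) (a : F) :=
  forall k, (k <= n)%N -> p`_k = a ^+ k / k`!%:R.

Lemma exp_coefs_mul n p q a b :
  exp_coefs n p a -> exp_coefs n q b -> exp_coefs n (p * q) (a + b).
Proof.
move=> pa qb k kn; rewrite coefM addrC exprDn mulr_suml; apply: eq_bigr => i _.
have ik : (i <= k)%N by rewrite -ltnS.
rewrite pa ?(leq_trans ik)// qb ?(leq_trans (leq_subr _ _))//.
have f0 (m : nat) : m`!%:R != 0 :> F by rewrite pnatr_eq0 -lt0n fact_gt0.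
rewrite -(bin_fact ik) !natrM -mulr_natr.
by field; rewrite !f0 pnatr_eq0 -lt0n bin_gt0 ik.
Qed.

Lemma exp_coefs_prod n (I : finType) (z : I -> F) :
  exp_coefs n (\prod_i exp_poly n (z i)) (\sum_i z i).
Proof.
apply: (big_rec2 (fun p a => exp_coefs n p a)) => [k kn|i p a _ pa].
  rewrite coef1; case: k {kn} => [|k]; first by rewrite expr0 fact0 divr1.
  by rewrite exprS mul0r mul0r.
apply: exp_coefs_mul pa => k kn.
by rewrite coef_poly ltnS kn.
Qed.

(** Both sides are the coefficient of X^n in the product of the series
    exp (z_i X), truncated at degree n. *)
Lemma multinomial_sum n (I : finType) (z : I -> F) :
  \sum_(v : {ffun I -> 'I_n.+1} | \sum_i (v i : nat) == n)
     \prod_i (z i ^+ v i / (v i)`!%:R) = (\sum_i z i) ^+ n / n`!%:R.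
Proof.
rewrite -(exp_coefs_prod z (leqnn n)) /exp_poly.
under [in RHS]eq_bigr => i _ do rewrite poly_def.
rewrite bigA_distr_bigA/= coef_sum big_mkcond/=; apply: eq_bigr => v _.
rewrite [in RHS]scaler_prod prodrXr coefZ coefXn.
by rewrite eq_sym; case: eqP => _; rewrite ?mulr1 ?mulr0.
Qed.

End truncated_exponential.

Section multinomial_expectation.
Variables (R : realType) (n : nat).
Implicit Types v : {ffun 'I_n -> 'I_n.+1}.

(** The probability that n balls thrown independently and uniformly into n boxes
    have occupation numbers v. *)
Definition multinomial_weight v : R :=
  if \sum_i (v i : nat) == n then
    n`!%:R / n%:R ^+ n * \prod_i ((v i)`!%:R)^-1 else 0.

Definition mexp (h : {ffun 'I_n -> 'I_n.+1} -> R) : R :=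
  \sum_v multinomial_weight v * h v.

Lemma multinomial_weight_ge0 v : 0 <= multinomial_weight v.
Proof.
rewrite /multinomial_weight; case: ifP => // _.
by rewrite mulr_ge0 ?divr_ge0 ?exprn_ge0 ?prodr_ge0// => i _; rewrite invr_ge0.
Qed.

Lemma mexp_le (h g : {ffun 'I_n -> 'I_n.+1} -> R) :
  (forall v, h v <= g v) -> mexp h <= mexp g.
Proof. by move=> hg; apply: ler_sum => v _; rewrite ler_wpM2l ?multinomial_weight_ge0. Qed.

Lemma mexp_ge0 (h : {ffun 'I_n -> 'I_n.+1} -> R) :
  (forall v, 0 <= h v) -> 0 <= mexp h.
Proof. by move=> h0; apply: sumr_ge0 => v _; rewrite mulr_ge0 ?multinomial_weight_ge0. Qed.

Lemma mexp0 : mexp (fun=> 0) = 0.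
Proof. by rewrite /mexp big1// => v _; rewrite mulr0. Qed.

Lemma mexpD h g : mexp (fun v => h v + g v) = mexp h + mexp g.
Proof. by rewrite -big_split; apply: eq_bigr => v _; rewrite mulrDr. Qed.

Lemma mexpZ c h : mexp (fun v => c * h v) = c * mexp h.
Proof. by rewrite big_distrr; apply: eq_bigr => v _; rewrite mulrCA. Qed.

Lemma mexpB h g : mexp (fun v => h v - g v) = mexp h - mexp g.
Proof.
rewrite (_ : (fun v => _) = (fun v => h v + -1 * g v)).
  by rewrite mexpD mexpZ mulN1r.
by apply/funext => v; rewrite mulN1r.
Qed.

Lemma mexp_sum (I : Type) (r : seq I) (h : I -> {ffun 'I_n -> 'I_n.+1} -> R) :
  mexp (fun v => \sum_(i <- r) h i v) = \sum_(i <- r) mexp (h i).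
Proof. by rewrite exchange_big; apply: eq_bigr => v _; rewrite big_distrr. Qed.

Lemma mexp_norm h : `|mexp h| <= mexp (fun v => `|h v|).
Proof.
apply: le_trans (ler_norm_sum _ _ _) _; apply: ler_sum => v _.
by rewrite normrM ger0_norm ?multinomial_weight_ge0.
Qed.

(** The only expectation under the multinomial law that is ever computed: all
    exponential moments are of this form. *)
Lemma mexp_prod (z : 'I_n -> R) :
  mexp (fun v => \prod_i z i ^+ v i) = ((\sum_i z i) / n%:R) ^+ n.
Proof.
transitivity (n`!%:R / n%:R ^+ n * ((\sum_i z i) ^+ n / n`!%:R)); last first.
  by rewrite exprMn exprVn mulrC -mulrA mulKf// pnatr_eq0 -lt0n fact_gt0.
rewrite -multinomial_sum big_distrr/= [RHS]big_mkcond/=; apply: eq_bigr => v _.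
rewrite /multinomial_weight; case: ifP => _; last by rewrite mul0r.
by rewrite -[LHS]mulrA -big_split; congr (_ * _); apply: eq_bigr => i _; rewrite /= mulrC.
Qed.

Hypothesis n_gt0 : (0 < n)%N.

Lemma mexp_cst c : mexp (fun=> c) = c.
Proof.
transitivity (c * mexp (fun v => \prod_i 1 ^+ v i)).
  by rewrite -mexpZ; congr mexp; apply/funext => v; rewrite big1 ?mulr1// => i _; rewrite expr1n.
by rewrite mexp_prod sumr_const card_ord divff ?expr1n ?mulr1// pnatr_eq0 -lt0n.
Qed.

End multinomial_expectation.

(** * Maximal inequality for the discrete bridge *)

Section maximal_inequality.
Variables (R : realType) (n : nat).
Implicit Types v : {ffun 'I_n -> 'I_n.+1}.
Variable S : nat -> {ffun 'I_n -> 'I_n.+1} -> R.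

Definition osc i L v : R := \big[Num.max/0]_(k < L.+1) `|S (i + k)%N v - S i v|.

Lemma osc_ge0 i L v : 0 <= osc i L v.
Proof. exact: bigmax_ge_id. Qed.

Lemma le_osc i L k v : (k <= L)%N -> `|S (i + k)%N v - S i v| <= osc i L v.
Proof.
move=> kL.
exact: (@le_bigmax _ _ _ _ (fun k : 'I_L.+1 => `|S (i + k)%N v - S i v|) (Ordinal (kL : (k < L.+1)%N))).
Qed.

(** Times before the midpoint are seen by the first half, and the later ones by
    the second half after the displacement D at the midpoint. *)
Lemma osc_bisect i L v (h := uphalf L) : (0 < L)%N ->
  osc i L v <= `|S (i + h)%N v - S i v| + Num.max (osc i h.-1 v) (osc (i + h) (L - h) v).
Proof.
move=> L0; apply: bigmax_le => [|k _].
  by rewrite addr_ge0 // le_max osc_ge0.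
have [kh|hk] := ltnP k h.
  apply: (@le_trans _ _ (osc i h.-1 v)).
    by apply: le_osc; rewrite -ltnS prednK// (leq_trans _ kh).
  by rewrite ler_wpDl// le_max lexx.
rewrite [_ - S i v](_ : _ = (S (i + h)%N v - S i v) + (S (i + k)%N v - S (i + h)%N v)); last by ring.
apply: le_trans (ler_normD _ _) _; rewrite lerD2l// le_max; apply/orP; right.
rewrite (_ : i + k = (i + h) + (k - h))%N; last by rewrite -addnA subnKC.
by apply: le_osc; rewrite leq_sub2r// -ltnS.
Qed.

(** Apply (a + b)^2 <= 11 a^2 + (11/10) b^2 twice. The bisection argument needs
    the factor of b^4 to be less than 2. *)
Lemma exprD4_le (a b : R) : (a + b) ^+ 4 <= 11 ^+ 3 * a ^+ 4 + 3 / 2 * b ^+ 4.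
Proof.
have h1 : (a + b) ^+ 2 <= 11 * a ^+ 2 + 11 / 10 * b ^+ 2.
  rewrite -subr_ge0 [leRHS](_ : _ = 10 * (a - b / 10) ^+ 2); last by field.
  by rewrite mulr_ge0 ?sqr_ge0.
have h2 : ((a + b) ^+ 2) ^+ 2 <= (11 * a ^+ 2 + 11 / 10 * b ^+ 2) ^+ 2.
  by rewrite ler_sqr ?nnegrE ?sqr_ge0// addr_ge0// mulr_ge0 ?sqr_ge0.
rewrite (_ : (a + b) ^+ 4 = ((a + b) ^+ 2) ^+ 2); last by ring.
apply: le_trans h2 _; rewrite -subr_ge0.
rewrite [leRHS](_ : _ = 10 * (11 * a ^+ 2 - 11 / 100 * b ^+ 2) ^+ 2 + 169 / 1000 * (b ^+ 2) ^+ 2); last by field.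
have := sqr_ge0 (11 * a ^+ 2 - 11 / 100 * b ^+ 2); have := sqr_ge0 (b ^+ 2).
move: (_ ^+ 2) (_ ^+ 2) => x y x0 y0; lra.
Qed.

(** Induction on L by bisection: the two halves contribute 2 (L/2)^2 = L^2 / 2,
    so the factor 3/2 of exprD4_le leaves a quarter of the bound for the fourth
    moment of the displacement at the midpoint. *)
Lemma maximal_fourth_moment (C : R) :
  (forall i L, mexp (fun v => (S (i + L)%N v - S i v) ^+ 4) <= C * L%:R ^+ 2) ->
  forall L i, mexp (fun v => osc i L v ^+ 4) <= (4 * 11 ^+ 3) * C * L%:R ^+ 2.
Proof.
move=> HC; have C0 : 0 <= C.
  have := HC 0%N 1%N; rewrite expr1n mulr1; apply: le_trans.
  by apply: mexp_ge0 => v; rewrite exprn_even_ge0.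
move=> L; have [m] := ubnP L; elim: m L => // m IH L Lm i.
have [->|L0] := posnP L.
  rewrite expr0n/= mulr0 (_ : (fun v => _) = (fun v => 0)); last first.
    by apply/funext => v; rewrite /osc big_ord_recl big_ord0 addn0 subrr normr0 maxxx expr0n.
  by rewrite mexp0.
set h := uphalf L.
have hL : (h.*2 <= L.+1)%N by rewrite /h; lia.
have Lh : (L <= h.*2)%N by rewrite /h; lia.
have step v : osc i L v ^+ 4 <= 11 ^+ 3 * (S (i + h)%N v - S i v) ^+ 4 +
    3 / 2 * (osc i h.-1 v ^+ 4 + osc (i + h) (L - h) v ^+ 4).
  apply: (@le_trans _ _ ((`|S (i + h)%N v - S i v| +
      Num.max (osc i h.-1 v) (osc (i + h) (L - h) v)) ^+ 4)).
    by rewrite lerXn2r ?nnegrE ?osc_ge0 ?osc_bisect// addr_ge0// le_max osc_ge0.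
  apply: le_trans (exprD4_le _ _) _; rewrite -normrX ger0_norm ?exprn_even_ge0//.
  rewrite lerD2l; apply: ler_wpM2l; first by lra.
  have h0 := exprn_ge0 4 (osc_ge0 i h.-1 v).
  have h1 := exprn_ge0 4 (osc_ge0 (i + h) (L - h) v).
  by have [_|_] := leP (osc i h.-1 v) (osc (i + h) (L - h) v); rewrite ?lerDl ?lerDr.
apply: le_trans (mexp_le step) _; rewrite mexpD !mexpZ mexpD.
have h1 := IH h.-1 ltac:(lia) i.
have h2 := IH (L - h)%N ltac:(lia) (i + h)%N.
have h3 := HC i h.
have e1 : (h.-1)%:R <= L%:R / 2 :> R.
  by rewrite ler_pdivlMr// -natrM ler_nat; lia.
have e2 : (L - h)%:R <= L%:R / 2 :> R.
  by rewrite ler_pdivlMr// -natrM ler_nat; lia.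
have e3 : h%:R <= L%:R :> R by rewrite ler_nat; lia.
have sq (x y : R) : 0 <= x -> x <= y -> x ^+ 2 <= y ^+ 2.
  by move=> x0 xy; rewrite lerXn2r// nnegrE// (le_trans x0).
have {}e1 := sq _ _ (ler0n _ _) e1; have {}e2 := sq _ _ (ler0n _ _) e2.
have {}e3 := sq _ _ (ler0n _ _) e3.
have K0 : 0 <= (4 * 11 ^+ 3) * C by rewrite mulr_ge0.
have {}e1 := ler_wpM2l K0 e1; have {}e2 := ler_wpM2l K0 e2.
have {}e3 := ler_wpM2l C0 e3.
have h4 := le_trans h1 e1; have h5 := le_trans h2 e2; have h6 := le_trans h3 e3.
apply: (@le_trans _ _ (11 ^+ 3 * (C * L%:R ^+ 2) +
    3 / 2 * ((4 * 11 ^+ 3) * C * (L%:R / 2) ^+ 2 + (4 * 11 ^+ 3) * C * (L%:R / 2) ^+ 2))).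
  by rewrite lerD// ler_wpM2l// lerD.
by rewrite le_eqVlt; apply/orP; left; apply/eqP; field.
Qed.

End maximal_inequality.

Section fourth_moment.
Variables (R : realType) (n : nat).
Hypothesis n_gt0 : (0 < n)%N.
Implicit Types v : {ffun 'I_n -> 'I_n.+1}.

(** The walk is stopped at time n, the number of coordinates of v, so that it is
    defined at the step n + 1 mentioned by the interpolation at time n. *)
Definition bridge_walk v (k : nat) : R := \sum_(j < n | (j < k)%N) ((v j)%:R - 1).

Lemma bridge_walk_diff v i L :
  bridge_walk v (i + L) - bridge_walk v i = \sum_(j < n | (i <= j < i + L)%N) ((v j)%:R - 1).
Proof.
rewrite /bridge_walk [X in X - _](bigID (fun j : 'I_n => (j < i)%N))/= addrAC.
rewrite (eq_bigl (fun j : 'I_n => (j < i)%N)) => [|j]; last first.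
  by case: (ltnP j i) => ji; rewrite ?andbF ?andbT// (leq_trans ji)// leq_addr.
by rewrite subrr add0r; apply: eq_bigl => j; rewrite -leqNgt andbC.
Qed.

Lemma mexp_expR (theta : 'I_n -> R) :
  mexp (fun v => expR (\sum_j theta j * (v j)%:R)) =
  ((\sum_j expR (theta j)) / n%:R) ^+ n.
Proof.
rewrite -mexp_prod; congr mexp; apply/funext => v.
by rewrite expR_sum; apply: eq_bigr => j _; rewrite expRM_natr.
Qed.

Lemma expR_le_quadratic (x : R) : `|x| <= 1 / 2 -> expR x <= 1 + x + 2 * x ^+ 2.
Proof.
rewrite ler_norml => /andP[x1 x2].
have h := expR_ge1Dx (- x).
have p : 0 < 1 - x by lra.
have : expR x <= (1 - x)^-1.
  by rewrite -[leLHS]invrK -expRN lef_pV2 ?posrE ?expR_gt0.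
move=> /le_trans; apply; rewrite -[leLHS]mul1r ler_pdivrMr// -subr_ge0.
rewrite [leRHS](_ : _ = x ^+ 2 * (1 - 2 * x)); last by ring.
by rewrite mulr_ge0 ?sqr_ge0//; lra.
Qed.

(** With c <= L boxes between i and i + L, the mean is
    e^(-tc) (1 + (c/n) (e^t - 1))^n <= exp (c (e^t - 1 - t)). *)
Lemma mexp_expR_increment (t : R) i L : `|t| <= 1 / 2 ->
  mexp (fun v => expR (t * (bridge_walk v (i + L) - bridge_walk v i))) <=
  expR (L%:R * (2 * t ^+ 2)).
Proof.
move=> t2; pose B (j : 'I_n) := (i <= j < i + L)%N.
have n0 : n%:R != 0 :> R by rewrite pnatr_eq0 -lt0n.
pose c : R := #|B|%:R.
have cL : c <= L%:R.
  rewrite ler_nat -sum1_card.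
  rewrite (_ : (\sum_(j < n | j \in B) 1)%N = \sum_(0 <= j < n | (i <= j < i + L)) 1)%N; last first.
    by rewrite big_mkord.
  rewrite big_mkcond/= (@leq_trans (\sum_(i <= j < i + L) 1))%N//; last first.
    by rewrite sum_nat_const_nat muln1 addKn.
  rewrite -big_mkcond/= -big_filter -[leqRHS]big_filter !sum1_size uniq_leq_size//.
    by rewrite filter_uniq ?iota_uniq.
  by move=> j; rewrite !mem_filter !mem_index_iota => /andP[->].
have -> : (fun v => expR (t * (bridge_walk v (i + L) - bridge_walk v i))) =
   (fun v => expR (- (t * c)) * expR (\sum_j (if B j then t else 0) * (v j)%:R)).
  apply/funext => v; rewrite -expRD bridge_walk_diff big_distrr/=.
  rewrite [in RHS](eq_bigr (fun j => if B j then t * (v j)%:R else 0)) => [|j _]; last first.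
    by case: ifP; rewrite ?mul0r.
  rewrite -big_mkcond/= (_ : - (t * c) = \sum_(j | B j) - t).
    by rewrite -big_split/=; congr expR; apply: eq_bigr => j _; rewrite mulrBr mulr1 addrC.
  by rewrite sumr_const -mulNr mulr_natr.
rewrite mexpZ mexp_expR.
have -> : (\sum_j expR (if B j then t else 0)) / n%:R = 1 + c / n%:R * (expR t - 1).
  have -> : \sum_j expR (if B j then t else 0) = \sum_(j < n) (1 + (if B j then expR t - 1 else 0)).
    by apply: eq_bigr => j _; case: ifP; rewrite ?expR0 ?addr0// addrC subrK.
  rewrite big_split/= sumr_const card_ord -big_mkcond/= sumr_const -mulr_natl.
  by rewrite -/c; field.
apply: (@le_trans _ _ (expR (- (t * c)) * expR (c / n%:R * (expR t - 1)) ^+ n)).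
  rewrite ler_wpM2l ?expR_ge0// lerXn2r ?nnegrE ?expR_ge0 ?expR_ge1Dx//.
  have cn : c / n%:R <= 1.
    rewrite ler_pdivrMr ?mul1r ?ltr0n// ler_nat.
    by rewrite -[leqRHS]card_ord max_card.
  have c0 : 0 <= c / n%:R by rewrite divr_ge0.
  rewrite [leRHS](_ : _ = (1 - c / n%:R) + c / n%:R * expR t); last by ring.
  by rewrite addr_ge0 ?subr_ge0// mulr_ge0 ?expR_ge0.
rewrite -expRM_natl -expRD ler_expR.
have -> : - (t * c) + n%:R * (c / n%:R * (expR t - 1)) = c * (expR t - 1 - t).
  by field.
have q := expR_le_quadratic t2.
apply: (@le_trans _ _ (c * (2 * t ^+ 2))).
  by rewrite ler_wpM2l//; lra.
by rewrite ler_wpM2r// mulr_ge0 ?sqr_ge0.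
Qed.

Lemma expr4_le_expR (x : R) : x ^+ 4 <= 4 ^+ 4 * (expR x + expR (- x)).
Proof.
have h (y : R) : 0 <= y -> y ^+ 4 <= 4 ^+ 4 * expR y.
  move=> y0; have h : y / 4 <= expR (y / 4) by apply: le_trans (expR_ge1Dx _); lra.
  have -> : expR y = expR (y / 4) ^+ 4 by rewrite -expRM_natl; congr expR; field.
  have {1}-> : y = 4 * (y / 4) by field.
  by rewrite exprMn ler_wpM2l ?exprn_ge0// lerXn2r ?nnegrE ?expR_ge0//; lra.
have c0 : 0 <= 4 ^+ 4 :> R by rewrite exprn_ge0.
have [x0|x0] := leP 0 x.
  by apply: le_trans (h _ x0) _; rewrite ler_wpM2l// lerDl expR_ge0.
have -> : x ^+ 4 = (- x) ^+ 4 by ring.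
apply: le_trans (h _ _) _; first by lra.
by rewrite ler_wpM2l// lerDr expR_ge0.
Qed.

(** For t = 1 / (2 sqrt L) the exponential moments of t D and - t D are bounded
    independently of L, and they control (t D)^4. *)
Lemma bridge_fourth_moment i L :
  mexp (fun v => (bridge_walk v (i + L) - bridge_walk v i) ^+ 4) <=
  4 ^+ 7 * L%:R ^+ 2.
Proof.
have [->|L0] := posnP L.
  rewrite expr0n/= mulr0 (_ : (fun v => _) = (fun v => 0)); last first.
    by apply/funext => v; rewrite addn0 subrr expr0n.
  by rewrite mexp0.
have sL : 1 <= Num.sqrt (L%:R : R) by rewrite -[leLHS]sqrtr1 ler_wsqrtr// ler1n.
set q := Num.sqrt L%:R in sL *.
have qL : q ^+ 2 = L%:R by rewrite sqr_sqrtr.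
pose t : R := (2 * q)^-1.
have t0 : 0 < t by rewrite invr_gt0; lra.
have t2 : `|t| <= 1 / 2.
  by rewrite gtr0_norm// /t -[leLHS]mul1r ler_pdivrMr//; lra.
have e : L%:R * (2 * t ^+ 2) = 1 / 2 :> R.
  by rewrite -qL /t; field; lra.
have e2 : expR (1 / 2) <= 2 :> R.
  by apply: le_trans (expR_le_quadratic _) _; [rewrite ger0_norm//; lra|lra].
have b v : (bridge_walk v (i + L) - bridge_walk v i) ^+ 4 <= 
  t ^- 4 * (4 ^+ 4 * (expR (t * (bridge_walk v (i + L) - bridge_walk v i)) +
    expR (- t * (bridge_walk v (i + L) - bridge_walk v i)))).
  rewrite mulrC ler_pdivlMr ?exprn_gt0// mulrC -exprMn mulNr.
  exact: expr4_le_expR.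
apply: le_trans (mexp_le b) _; rewrite !mexpZ mexpD.
have h1 := mexp_expR_increment i L t2; rewrite e in h1.
have t2' : `|- t| <= 1 / 2 by rewrite normrN.
have h2 := mexp_expR_increment i L t2'; rewrite sqrrN e in h2.
apply: (@le_trans _ _ (t ^- 4 * (4 ^+ 4 * (2 + 2)))).
  apply: ler_wpM2l; first by rewrite invr_ge0 exprn_ge0// ltW.
  apply: ler_wpM2l; first by rewrite exprn_ge0.
  by apply: lerD; [exact: le_trans h1 _|exact: le_trans h2 _].
have -> : t ^- 4 * (4 ^+ 4 * (2 + 2)) = 4 ^+ 7 * (q ^+ 2) ^+ 2.
  by rewrite /t exprVn invrK; ring.
by rewrite qL.
Qed.

Definition maximal_constant : R := (4 * 11 ^+ 3) * 4 ^+ 7.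

Lemma bridge_maximal_inequality i L :
  mexp (fun v => osc (fun k v => bridge_walk v k) i L v ^+ 4) <= maximal_constant * L%:R ^+ 2.
Proof. exact: (maximal_fourth_moment bridge_fourth_moment). Qed.

End fourth_moment.

(** * Exponential moments of the discrete bridge *)

Section multinomial_clt.
Variable R : realType.

Lemma mexp_expR_centered n (theta : 'I_n -> R) : (0 < n)%N ->
  mexp (fun v => expR (\sum_j theta j * ((v j)%:R - 1))) =
  ((\sum_j expR (theta j - (\sum_i theta i) / n%:R)) / n%:R) ^+ n.
Proof.
move=> n0; set S := \sum_i theta i.
have nn : n%:R != 0 :> R by rewrite pnatr_eq0 -lt0n.
have -> : (fun v : {ffun 'I_n -> 'I_n.+1} => expR (\sum_j theta j * ((v j)%:R - 1))) =
    (fun v : {ffun 'I_n -> 'I_n.+1} => expR (- S) * expR (\sum_j theta j * (v j)%:R)).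
  apply/funext => v; rewrite -expRD; congr expR.
  rewrite -sumrN -big_split/=; apply: eq_bigr => j _.
  by rewrite mulrBr mulr1 addrC.
rewrite mexpZ mexp_expR.
have -> : expR (- S) = expR (- (S / n%:R)) ^+ n.
  by rewrite -expRM_natl; congr expR; field.
rewrite -exprMn; congr (_ ^+ _); rewrite mulrA big_distrr/=; congr (_ / _).
by apply: eq_bigr => j _; rewrite -expRD addrC.
Qed.

(** The mean is A^n, where A averages exp (th_j) over the centered weights
    th_j = O(1 / sqrt n). With V the sum of the th_j^2, both A and exp (V / (2n)) are
    1 + V / (2n) + O(n^(-3/2)), and the n-th power multiplies their distance by at
    most a constant times n. *)
Lemma multinomial_mgf_error (B : R) : 0 <= B -> exists C : R, forall n (theta : 'I_n -> R),
  (0 < n)%N ->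
  (forall j, `|theta j - (\sum_i theta i) / n%:R| <= B / Num.sqrt n%:R) ->
  `|mexp (fun v => expR (\sum_j theta j * ((v j)%:R - 1))) -
    expR ((\sum_j theta j ^+ 2 - (\sum_j theta j) ^+ 2 / n%:R) / 2)| <= C / Num.sqrt n%:R.
Proof.
move=> B0; pose D := B ^+ 2 * expR B.
have D0 : 0 <= D by rewrite mulr_ge0 ?sqr_ge0 ?expR_ge0.
exists ((B ^+ 3 * expR B + D ^+ 2 * expR D) * expR D) => n theta n0 hB.
have nn : 0 < n%:R :> R by rewrite ltr0n.
rewrite mexp_expR_centered//; set S := \sum_i theta i in hB *.
pose th j := theta j - S / n%:R.
set q := Num.sqrt n%:R in hB *.
have q1 : 1 <= q by rewrite -[leLHS]sqrtr1 ler_wsqrtr// ler1n.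
have q2 : q ^+ 2 = n%:R by rewrite sqr_sqrtr.
have {}hB j : `|th j| <= B / q := hB j.
have thB j : `|th j| <= B.
  by apply: le_trans (hB j) _; rewrite ler_pdivrMr; nra.
have sum0 : \sum_j th j = 0.
  rewrite /th sumrB sumr_const card_ord -[_ *+ n]mulr_natr divfK ?gt_eqF// subrr//.
pose V := (\sum_j th j ^+ 2).
have VE : \sum_j theta j ^+ 2 - S ^+ 2 / n%:R = V.
  rewrite /V /th; under [in RHS]eq_bigr do rewrite sqrrB.
  rewrite big_split/= sumr_const card_ord -[_ *+ n]mulr_natr sumrB.
  under [X in _ = _ - X + _]eq_bigr do rewrite -mulr_natr mulrAC.
  by rewrite -mulr_suml -/S -mulr_suml -/S; field; lra.
rewrite VE.
pose A := (\sum_j expR (th j)) / n%:R.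
change (`|A ^+ n - expR (V / 2)| <= ((B ^+ 3 * expR B + D ^+ 2 * expR D) * expR D) / q).
clear VE; clearbody th.
have thsq j : th j ^+ 2 <= B ^+ 2 / n%:R.
  by rewrite -real_normK ?num_real// -q2 -expr_div_n lerXn2r ?nnegrE// divr_ge0//; lra.
have V0 : 0 <= V by apply: sumr_ge0 => j _; exact: sqr_ge0.
have VB : V <= B ^+ 2.
  apply: le_trans (ler_sum _ (fun j _ => thsq j)) _.
  by rewrite sumr_const card_ord -[_ *+ n]mulr_natr divfK// gt_eqF.
have eB1 : 1 <= expR B by rewrite -[leLHS]expR0 ler_expR.
have VD : V <= D by apply: le_trans VB _; rewrite ler_peMr ?sqr_ge0.
have avg (f : 'I_n -> R) c : (forall j, f j <= c) -> (\sum_j f j) / n%:R <= c.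
  move=> fc; rewrite ler_pdivrMr//; apply: le_trans (ler_sum _ (fun j _ => fc j)) _.
  by rewrite sumr_const card_ord mulr_natr.
have avgE (f : 'I_n -> R) : (\sum_j (1 + th j + f j)) / n%:R = 1 + (\sum_j f j) / n%:R.
  by rewrite !big_split/= sum0 addr0 sumr_const card_ord; field; lra.
have AE : A = 1 + (\sum_j (expR (th j) - 1 - th j)) / n%:R.
  by rewrite -avgE /A; congr (_ / _); apply: eq_bigr => j _; ring.
(* Bb bounds both bases of the n-th powers, and Bb ^ n does not depend on n *)
pose Bb := expR (D / n%:R).
have Bbn : Bb ^+ n = expR D by rewrite /Bb -expRM_natl; congr expR; field; lra.
have Dn0 : 0 <= D / n%:R by apply: divr_ge0 => //; lra.
have Bb1 : 1 <= Bb by rewrite /Bb -[leLHS]expR0 ler_expR.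
have A0 : 0 <= A by rewrite divr_ge0// sumr_ge0// => j _; rewrite expR_ge0.
have ABb : `|A| <= Bb.
  rewrite ger0_norm// AE; apply: le_trans (expR_ge1Dx _); rewrite lerD2l.
  apply: avg => j; have /ler_normlP[_ h] := expR_taylor1 (th j).
  apply: le_trans h _; rewrite /D [leRHS]mulrAC; apply: ler_pM; rewrite ?sqr_ge0 ?expR_ge0 ?ler_expR//.
pose W := expR (V / n%:R / 2).
have WE : expR (V / 2) = W ^+ n by rewrite /W -expRM_natl; congr expR; field; lra.
have WBb : `|W| <= Bb.
  rewrite ger0_norm ?expR_ge0// ler_expR.
  have : V / n%:R <= D / n%:R by rewrite ler_pM2r ?invr_gt0.
  have : 0 <= V / n%:R by rewrite divr_ge0.
  lra.
rewrite WE; apply: le_trans (ler_norm_subX n Bb1 ABb WBb) _; rewrite Bbn.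
rewrite [leRHS]mulrAC; apply: ler_wpM2r; first exact: expR_ge0.
have h1 : `|A - 1 - V / n%:R / 2| <= B ^+ 3 * expR B / q ^+ 3.
  have -> : A - 1 - V / n%:R / 2 = (\sum_j (expR (th j) - 1 - th j - th j ^+ 2 / 2)) / n%:R.
    rewrite AE [in RHS]sumrB -[in RHS]mulr_suml -/V; field; lra.
  rewrite normrM [X in _ * X]gtr0_norm ?invr_gt0//.
  apply: (@le_trans _ _ ((\sum_j `|expR (th j) - 1 - th j - th j ^+ 2 / 2|) / n%:R)).
    by rewrite ler_wpM2r ?invr_ge0 ?ler_norm_sum// ltW.
  apply: avg => j; apply: le_trans (expR_taylor2 _) _.
  rewrite [leRHS]mulrAC -expr_div_n; apply: ler_pM; rewrite ?exprn_ge0 ?expR_ge0 ?ler_expR//.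
  by rewrite lerXn2r ?nnegrE// divr_ge0//; lra.
have h2 : `|W - 1 - V / n%:R / 2| <= D ^+ 2 * expR D / q ^+ 3.
  have x0 : 0 <= V / n%:R / 2 by rewrite !divr_ge0.
  have x1 : V / n%:R / 2 <= D / q ^+ 2.
    rewrite q2; have : V / n%:R <= D / n%:R by rewrite ler_pM2r ?invr_gt0.
    lra.
  apply: le_trans (expR_taylor1 _) _; rewrite (ger0_norm x0) [leRHS]mulrAC.
  have qn m : 1 <= q ^+ m by rewrite exprn_ege1.
  apply: ler_pM; rewrite ?sqr_ge0 ?expR_ge0//.
    apply: (@le_trans _ _ ((D / q ^+ 2) ^+ 2)).
      by rewrite lerXn2r ?nnegrE// (le_trans x0).
    rewrite expr_div_n -exprM ler_wpM2l ?sqr_ge0//.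
    rewrite lef_pV2 ?posrE; [|have := qn 4%N; lra|have := qn 3%N; lra].
    by rewrite ler_weXn2l.
  rewrite ler_expR (le_trans x1)// ler_pdivrMr; last by have := qn 2%N; lra.
  by rewrite ler_peMr.
have -> : A - W = (A - 1 - V / n%:R / 2) - (W - 1 - V / n%:R / 2) by ring.
apply: (@le_trans _ _ (n%:R * (B ^+ 3 * expR B / q ^+ 3 + D ^+ 2 * expR D / q ^+ 3))).
  by rewrite ler_wpM2l//; apply: le_trans (ler_normB _ _) _; exact: lerD.
by rewrite -q2 le_eqVlt; apply/orP; left; apply/eqP; field; lra.
Qed.

(** Weight of the j-th increment in the value at time x of an interpolated
    sequence. *)
Definition hat (x : R) (j : nat) : R := Num.max 0 (Num.min 1 (x - j%:R)).

Lemma hat_bounds x j : 0 <= hat x j <= 1.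
Proof. by rewrite /hat le_max lexx/= ge_max ler01 ge_min lexx. Qed.

Lemma hat_le x y j : x <= y -> hat x j <= hat y j.
Proof.
move=> xy; rewrite /hat.
have [hx|hx] := leP 1 (x - j%:R); have [hy|hy] := leP 1 (y - j%:R) => //; first by lra.
  by rewrite ge_max !le_max lexx (ltW hx) orbT.
by have [h1|h1] := leP 0 (x - j%:R); have [h2|h2] := leP 0 (y - j%:R); lra.
Qed.

Lemma hat_eq0 x j : x <= j%:R -> hat x j = 0.
Proof. by move=> xj; rewrite /hat max_l// ge_min; apply/orP; right; lra. Qed.

Lemma hat_eq1 x j : j.+1%:R <= x -> hat x j = 1.
Proof. by rewrite -natr1 => xj; rewrite /hat min_l ?max_r//; lra. Qed.

(** Apply the interpolation formula to the identity sequence. *)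
Lemma sum_hat (n : nat) (x : R) : 0 <= x <= n%:R -> \sum_(j < n) hat x j = x.
Proof.
move=> /andP[x0 xn].
have := @interpE R (fun k => k%:R) n.+1 x x0 _; rewrite -natr1 => /(_ ltac:(lra)).
rewrite /interp -[in X in _ + _ * X]natr1 addrAC subrr add0r mulr1 addrC subrK big_ord_recr/=.
rewrite -/(hat x n) hat_eq0// mul0r addr0 add0r => H; rewrite [RHS]H.
by apply: eq_bigr => j _; rewrite -/(hat x j) -natr1 addrAC subrr add0r mulr1.
Qed.

(** For x <= y, the difference of hat x j and hat x j * hat y j vanishes unless j is
    the integer part of x. *)
Lemma sum_hatM (n : nat) (x y : R) : 0 <= x <= n%:R -> 0 <= y <= n%:R ->
  `|\sum_(j < n) hat x j * hat y j - Num.min x y| <= 1.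
Proof.
wlog xy : x y / x <= y => [H hx hy|].
  have [xy|yx] := leP x y; first by have := H x y xy hx hy; rewrite (min_l xy).
  have := H y x (ltW yx) hy hx; rewrite (min_l (ltW yx)).
  by under eq_bigr do rewrite mulrC.
move=> hx hy; rewrite min_l// -[X in _ - X](sum_hat hx) distrC -sumrB.
have b j : 0 <= hat x j - hat x j * hat y j <= (j == Num.truncn x)%:R.
  have /andP[x0 x1] := hat_bounds x j; have /andP[y0 y1] := hat_bounds y j.
  have xyj := hat_le j xy.
  have p1 : 0 <= hat x j * hat y j by rewrite mulr_ge0.
  have p2 : hat x j * hat y j <= hat x j by rewrite ler_piMr.
  have [jx|jx] := eqVneq j (Num.truncn x); first by rewrite mulr1n; apply/andP; split; lra.
  have /andP[/truncn_itv/andP[t1 t2] _] := hx.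
  have [jx'|xj] := ltnP j (Num.truncn x).
    have h : hat x j = 1 by apply: hat_eq1; rewrite (le_trans _ t1)// ler_nat.
    have h' : hat y j = 1 by apply/eqP; rewrite eq_le y1 -h.
    by rewrite h h' mulr1 subrr lexx.
  rewrite hat_eq0 ?mul0r ?subrr ?lexx//.
  by rewrite (le_trans (ltW t2))// ler_nat ltn_neqAle eq_sym jx.
rewrite ger0_norm; last by apply: sumr_ge0 => j _; have /andP[] := b j.
apply: (@le_trans _ _ (\sum_(j < n) ((j : nat) == Num.truncn x)%:R)).
  by apply: ler_sum => j _; have /andP[] := b j.
have [tn|nt] := ltnP (Num.truncn x) n; last first.
  by rewrite big1// => j _; rewrite ltn_eqF// (leq_trans (ltn_ord j)).
rewrite (bigD1 (Ordinal tn))//= eqxx big1 ?addr0// => j.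
by rewrite -val_eqE/= => /negbTE ->.
Qed.

Definition bridge_path n (v : {ffun 'I_n -> 'I_n.+1}) (t : R) : R :=
  interp (bridge_walk R v) (n%:R * t) / Num.sqrt n%:R.

Lemma bridge_pathE n (v : {ffun 'I_n -> 'I_n.+1}) (t : R) : 0 <= t <= 1 ->
  bridge_path v t = (\sum_(j < n) hat (n%:R * t) j * ((v j)%:R - 1)) / Num.sqrt n%:R.
Proof.
move=> /andP[t0 t1]; rewrite /bridge_path (@interpE _ _ n.+1).
- congr (_ / _); rewrite {1}/bridge_walk big1 ?add0r// big_ord_recr/=.
  rewrite -/(hat _ n) hat_eq0 ?ler_piMr// mul0r addr0; apply: eq_bigr => j _.
  rewrite -/(hat _ j); congr (_ * _); have := bridge_walk_diff R v j 1.
  rewrite addn1 => ->; rewrite (bigD1 j)/= ?leqnn ?ltnSn// big1 ?addr0// => i.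
  by rewrite ltnS andbC -eqn_leq eq_sym val_eqE andNb.
- by rewrite mulr_ge0.
- by rewrite (@le_lt_trans _ _ n%:R) ?ltr_nat// ler_piMr.
Qed.

(** The linear form is the sum of theta_j (v_j - 1) with weights theta_j of order
    1 / sqrt n. By sum_hat and sum_hatM, their centered sum of squares differs by
    O(1 / n) from the variance of the same linear form of the Brownian bridge. *)
Lemma bridge_mgf_cvg (k : nat) (a t : 'I_k -> R) : (forall i, 0 <= t i <= 1) ->
  mexp (fun v : {ffun 'I_n -> 'I_n.+1} => expR (\sum_i a i * bridge_path v (t i)))
    @[n --> \oo] -->
  expR ((\sum_i \sum_i' a i * a i' * (Num.min (t i) (t i') - t i * t i')) / 2).
Proof.
move=> t01; pose B := 2 * \sum_i `|a i|.
have sa0 : 0 <= \sum_i `|a i| by apply: sumr_ge0.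
have B0 : 0 <= B by rewrite mulr_ge0.
have [C HC] := multinomial_mgf_error B0.
pose theta n (j : 'I_n) : R := (\sum_i a i * hat (n%:R * t i) j) / Num.sqrt n%:R.
pose V n : R := \sum_j (@theta n j) ^+ 2 - (\sum_j (@theta n j)) ^+ 2 / n%:R.
set sigma2 := \sum_i _.
have nt n i : 0 <= n%:R * t i <= n%:R.
  by have /andP[t0 t1] := t01 i; rewrite mulr_ge0//= ler_piMr.
have thb n j : `|@theta n j| <= (\sum_i `|a i|) / Num.sqrt n%:R.
  rewrite normrM [X in _ * X]ger0_norm ?invr_ge0// ler_wpM2r ?invr_ge0//.
  apply: le_trans (ler_norm_sum _ _ _) _; apply: ler_sum => i _.
  have /andP[h0 h1] := hat_bounds (n%:R * t i) j.
  by rewrite normrM ler_piMr// ger0_norm.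
have key n : (0 < n)%N ->
    `|mexp (fun v : {ffun 'I_n -> 'I_n.+1} => expR (\sum_i a i * bridge_path v (t i))) - expR (V n / 2)| <= C / Num.sqrt n%:R.
  move=> n0; have nn : 0 < n%:R :> R by rewrite ltr0n.
  have -> : (fun v : {ffun 'I_n -> 'I_n.+1} => expR (\sum_i a i * bridge_path v (t i))) =
     (fun v : {ffun 'I_n -> 'I_n.+1} => expR (\sum_j @theta n j * ((v j)%:R - 1))).
    apply/funext => v; congr expR.
    transitivity (\sum_i \sum_(j < n) a i * hat (n%:R * t i) j / Num.sqrt n%:R * ((v j)%:R - 1)).
      apply: eq_bigr => i _; rewrite bridge_pathE// mulrA big_distrr/= big_distrl/=.
      by apply: eq_bigr => j _; ring.
    rewrite exchange_big/=; apply: eq_bigr => j _.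
    by rewrite /theta !big_distrl.
  apply: HC => // j; apply: le_trans (ler_normB _ _) _.
  rewrite /B -mulrA mulr_natl mulr2n lerD//.
  rewrite normrM [X in _ * X]gtr0_norm ?invr_gt0// ler_pdivrMr//.
  apply: le_trans (ler_norm_sum _ _ _) _.
  apply: le_trans (ler_sum _ (fun j _ => thb n j)) _.
  by rewrite sumr_const card_ord mulr_natr.
have Verr n : (0 < n)%N -> `|V n - sigma2| <= (\sum_i \sum_i' `|a i| * `|a i'|) / n%:R.
  move=> n0; have nn : 0 < n%:R :> R by rewrite ltr0n.
  have q2 : Num.sqrt n%:R ^+ 2 = n%:R :> R by rewrite sqr_sqrtr.
  have q0 : Num.sqrt n%:R != 0 :> R by rewrite gt_eqF// sqrtr_gt0.
  have E1 : \sum_j (@theta n j) ^+ 2 =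
     (\sum_i \sum_i' a i * a i' * (\sum_(j < n) hat (n%:R * t i) j * hat (n%:R * t i') j)) / n%:R.
    transitivity ((\sum_(j < n) \sum_i \sum_i' a i * hat (n%:R * t i) j * (a i' * hat (n%:R * t i') j)) / n%:R).
      rewrite big_distrl/=; apply: eq_bigr => j _.
      rewrite /theta expr_div_n q2 expr2 big_distrl/=; congr (_ / _).
      by apply: eq_bigr => i _; rewrite big_distrr.
    congr (_ / _); rewrite exchange_big/=; apply: eq_bigr => i _.
    rewrite exchange_big/=; apply: eq_bigr => i' _.
    by rewrite big_distrr/=; apply: eq_bigr => j _; ring.
  have E2 : \sum_j (@theta n j) = (\sum_i a i * t i) * n%:R / Num.sqrt n%:R.
    rewrite -big_distrl/=; congr (_ / _); rewrite exchange_big big_distrl/=.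
    by apply: eq_bigr => i _; rewrite -big_distrr/= sum_hat// mulrCA mulrC.
  have E3 : (\sum_j (@theta n j)) ^+ 2 / n%:R = \sum_i \sum_i' a i * a i' * (t i * t i').
    rewrite E2 expr_div_n q2 [LHS](_ : _ = (\sum_i a i * t i) ^+ 2); last by field; lra.
    rewrite expr2 big_distrl/=; apply: eq_bigr => i _.
    by rewrite big_distrr/=; apply: eq_bigr => i' _; ring.
  have -> : V n - sigma2 = (\sum_i \sum_i' a i * a i' *
      ((\sum_(j < n) hat (n%:R * t i) j * hat (n%:R * t i') j) - Num.min (n%:R * t i) (n%:R * t i'))) / n%:R.
    rewrite /V E1 E3 /sigma2 !big_distrl/= -!sumrB; apply: eq_bigr => i _.
    rewrite !big_distrl/= -!sumrB; apply: eq_bigr => i' _.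
    have -> : Num.min (n%:R * t i) (n%:R * t i') = n%:R * Num.min (t i) (t i').
      by rewrite minr_pMr// ltW.
    by field; lra.
  rewrite normrM [X in _ * X]gtr0_norm ?invr_gt0// ler_wpM2r ?invr_ge0//.
  apply: le_trans (ler_norm_sum _ _ _) _; apply: ler_sum => i _.
  apply: le_trans (ler_norm_sum _ _ _) _; apply: ler_sum => i' _.
  by rewrite !normrM ler_piMr ?mulr_ge0// sum_hatM.
have cinv : (n%:R^-1 : R) @[n --> \oo] --> (0 : R).
  by apply/gtr0_cvgV0; [near=> n; rewrite ltr0n; near: n; exists 1%N|exact: cvgr_idn].
have csq : ((Num.sqrt n%:R)^-1 : R) @[n --> \oo] --> (0 : R).
  have -> : (fun n : nat => (Num.sqrt n%:R)^-1 : R) = (fun n => Num.sqrt (n%:R^-1)).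
    by apply/funext => n; rewrite sqrtrV.
  by rewrite -(@sqrtr0 R); apply: continuous_cvg => //; exact: sqrt_continuous.
have cV : V n @[n --> \oo] --> sigma2.
  apply/subr_cvg0/norm_cvg0P.
  apply: (@squeeze_cvgr _ _ _ _ (fun=> 0) (fun n => (\sum_i \sum_i' `|a i| * `|a i'|) / n%:R)).
  - by near=> n; rewrite normr_ge0/= Verr//; near: n; exists 1%N.
  - exact: cvg_cst.
  - by rewrite -[X in _ --> X](mulr0 (\sum_i \sum_i' `|a i| * `|a i'|)); apply: cvgM => //; exact: cvg_cst.
have cE : expR (V n / 2) @[n --> \oo] --> expR (sigma2 / 2).
  apply: continuous_cvg; first exact: continuous_expR.
  by apply: cvgM => //; exact: cvg_cst.
rewrite -[X in _ --> X]add0r.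
rewrite (_ : (fun n => _) = (fun n =>
  (mexp (fun v : {ffun 'I_n -> 'I_n.+1} => expR (\sum_i a i * bridge_path v (t i))) -
   expR (V n / 2)) + expR (V n / 2))); last first.
  by apply/funext => n; rewrite subrK.
apply: cvgD => //; apply/norm_cvg0P.
apply: (@squeeze_cvgr _ _ _ _ (fun=> 0) (fun n => C / Num.sqrt n%:R)).
- by near=> n; rewrite normr_ge0/= key//; near: n; exists 1%N.
- exact: cvg_cst.
- by rewrite -[X in _ --> X](mulr0 C); apply: cvgM => //; exact: cvg_cst.
Unshelve. all: by end_near.
Qed.

End multinomial_clt.

(** * Law of the Poisson walk conditioned to return to 0 *)

Section conditional_law.
Context d (T : measurableType d) (R : realType) (P : probability T R).
Variable Poi : nat -> {RV P >-> nat}.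
Hypothesis Poi_indep : mutually_independent Poi.
Hypothesis Poi_law : forall j, is_poisson 1 (Poi j).
Variable n : nat.
Hypothesis n_gt0 : (0 < n)%N.
Implicit Types v : {ffun 'I_n -> 'I_n.+1}.

Definition counts_event v : set T := [set w | forall j : 'I_n, Poi j w = v j].

Lemma poisson_point j k : P (Poi j @^-1` [set k]) = (expR (- 1) / k`!%:R)%:E.
Proof.
transitivity (distribution P (Poi j) [set k]); first by [].
rewrite Poi_law /poisson_prob ltr01 esum_set1; last by rewrite lee_fin poisson_pmf_ge0.
by rewrite /poisson_pmf ltr01 expr1n mul1r mulrC.
Qed.

(** Presents the event as an intersection over a finite set of indices, as
    independence requires. *)
Lemma counts_eventE v : exists J : {fset nat}, exists B : nat -> set nat,
  [/\ counts_event v = \bigcap_(j in [set` J]) (Poi j @^-1` B j),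
      perm_eq J (index_iota 0 n) & forall j : 'I_n, B j = [set (v j : nat)]].
Proof.
exists [fset j in index_iota 0 n]%fset, (fun j => [set k | forall i : 'I_n, i = j :> nat -> k = v i :> nat]).
split.
- apply/seteqP; split=> w /=.
    by move=> wv j _ i /= ij; rewrite -ij.
  move=> wv j; apply: (wv j) => //=.
  by rewrite !inE mem_index_iota leq0n ltn_ord.
- apply: uniq_perm; [exact: fset_uniq|exact: iota_uniq|].
  by move=> j; rewrite !inE.
- move=> j; apply/seteqP; split=> k /=; first exact.
  by move=> -> i /val_inj ->.
Qed.

Lemma measurable_counts_event v : measurable (counts_event v).
Proof.
have [J [B [-> _ _]]] := counts_eventE v.
apply: fin_bigcap_measurable => [|j _]; first exact: finite_fset.
by rewrite -[X in measurable X]setTI; exact: measurable_funP.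
Qed.

Lemma counts_probability v :
  P (counts_event v) = (\prod_j (expR (- 1) / (v j)`!%:R))%:E.
Proof.
have [J [B [-> Jn Bv]]] := counts_eventE v.
rewrite Poi_indep; last by [].
rewrite (perm_big _ Jn)/= big_mkord.
rewrite -prodEFin; apply: eq_bigr => j _.
by rewrite Bv poisson_point.
Qed.

Local Notation A := [set w | walk Poi n w = 0].

Lemma walk0_counts w : A w -> exists2 v : {ffun 'I_n -> 'I_n.+1}, \sum_j (v j : nat) = n & counts_event v w.
Proof.
rewrite /= /walk sumrB sumr_const card_ord -natr_sum => /eqP.
rewrite subr_eq0 eqr_nat => /eqP wn.
have le_n (j : 'I_n) : (Poi j w < n.+1)%N.
  by rewrite ltnS -[leqRHS]wn (bigD1 j)//= leq_addr.
exists [ffun j : 'I_n => inord (Poi j w)].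
  by rewrite -[RHS]wn; apply: eq_bigr => j _; rewrite ffunE inordK.
by move=> j; rewrite ffunE inordK.
Qed.

Lemma counts_walk0 v w : counts_event v w -> A w <-> \sum_j (v j : nat) = n.
Proof.
move=> wv; rewrite /= /walk (eq_bigr (fun j => (v j)%:R - 1)) => [|j _]; last by rewrite wv.
rewrite sumrB sumr_const card_ord -natr_sum; split => [/eqP|->]; last by rewrite subrr.
by rewrite subr_eq0 eqr_nat => /eqP.
Qed.

Lemma counts_event_inj u v w : counts_event u w -> counts_event v w -> u = v.
Proof. by move=> wu wv; apply/ffunP => j; apply/val_inj; rewrite /= -wu wv. Qed.

Lemma sum_counts_indic (c : {ffun 'I_n -> 'I_n.+1} -> R) v w : counts_event v w ->
  \sum_u c u * \1_(counts_event u) w = c v.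
Proof.
move=> wv; rewrite (bigD1 v)//= indicE mem_set// mulr1 big1 ?addr0// => u uv.
rewrite indicE memNset ?mulr0// => wu.
by move/eqP: uv; apply; exact: counts_event_inj wu wv.
Qed.

Lemma integral_counts (Q : probability T R) (c : {ffun 'I_n -> 'I_n.+1} -> R) :
  (\int[Q]_w (\sum_u c u * \1_(counts_event u) w)%:E)%E =
  (\sum_u c u * fine (Q (counts_event u)))%:E.
Proof.
have ii u : integr Q (fun w => c u * \1_(counts_event u) w).
  apply: integrZ; apply: (@integr_bounded _ _ _ _ _ 1) => [|w].
    exact: measurable_indic (measurable_counts_event u).
  by rewrite indicE; case: (_ \in _); rewrite ?normr1 ?normr0.
rewrite -[LHS]fineK; last by apply: integrable_fin_num => //; exact: (integr_sum _ ii).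
congr EFin; rewrite -[LHS]/(\int[Q]_w _) Rintegral_sumT//; apply: eq_bigr => u _.
have mu := measurable_counts_event u.
rewrite RintegralZl//; last first.
  apply: (@integr_bounded _ _ _ _ _ 1) => [|w]; first exact: measurable_indic.
  by rewrite indicE; case: (_ \in _); rewrite ?normr1 ?normr0.
by rewrite /Rintegral integral_indic// setIT.
Qed.

(** Sum the probabilities of the possible occupation numbers, with
    multinomial_sum at z = 1. *)
Lemma walk0_probability : P A = (expR (- n%:R) * (n%:R ^+ n / n`!%:R))%:E.
Proof.
have mA := measurable_walk0 Poi n.
transitivity (\int[P]_w (\1_A w)%:E)%E; first by rewrite integral_indic// setIT.
pose c (v : {ffun 'I_n -> 'I_n.+1}) : R := if \sum_j (v j : nat) == n then 1 else 0.
transitivity (\int[P]_w (\sum_u c u * \1_(counts_event u) w)%:E)%E.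
  apply: eq_integral => w _; congr EFin.
  rewrite indicE; have [Aw|nAw] := pselect (A w).
    have [v vn wv] := walk0_counts Aw.
    by rewrite mem_set// (sum_counts_indic _ wv) /c vn eqxx.
  rewrite memNset//; apply/esym; apply: big1 => u _; rewrite /c.
  case: eqP => [un|_]; last by rewrite mul0r.
  by rewrite indicE memNset ?mulr0// => wu; apply: nAw; exact/(counts_walk0 wu).
rewrite integral_counts; congr EFin.
have := @multinomial_sum R n 'I_n (fun=> 1).
rewrite sumr_const card_ord => <-; rewrite big_distrr/= big_mkcond [RHS]big_mkcond/=.
apply: eq_bigr => v _; rewrite /c; case: ifP => _; last by rewrite mul0r.
rewrite mul1r counts_probability/= big_split/= prodr_const card_ord -expRM_natl mulrN1.
by congr (_ * _); apply: eq_bigr => j _; rewrite expr1n mul1r.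
Qed.

Lemma cond_probE U : cond_prob P (measurable_walk0 Poi n) U =
  (P (U `&` A) * (expR (- n%:R) * (n%:R ^+ n / n`!%:R))^-1%:E)%E.
Proof.
have pA : 0 < expR (- n%:R) * (n%:R ^+ n / n`!%:R) :> R.
  by rewrite mulr_gt0 ?expR_gt0// divr_gt0 ?exprn_gt0 ?ltr0n ?fact_gt0.
change ((if (P (setT `&` A) == 0) || (P (setT `&` A) == +oo) then (fun U => P U)
  else fun U => P (U `&` A) * (fine (P (setT `&` A)))^-1%:E) U =
  P (U `&` A) * (expR (- n%:R) * (n%:R ^+ n / n`!%:R))^-1%:E)%E.
rewrite setTI walk0_probability/=.
by rewrite eqe gt_eqF.
Qed.

Lemma cond_counts v :
  cond_prob P (measurable_walk0 Poi n) (counts_event v) = (multinomial_weight R v)%:E.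
Proof.
have n0 : 0 < n%:R :> R by rewrite ltr0n.
rewrite cond_probE /multinomial_weight; case: eqP => [vn|vn]; last first.
  rewrite (_ : _ `&` _ = set0) ?measure0 ?mul0e//.
  by apply/seteqP; split=> // w [wv /(counts_walk0 wv)].
rewrite setIidl; last by move=> w wv; apply/(counts_walk0 wv).
rewrite counts_probability -EFinM; congr EFin.
rewrite big_split/= prodr_const card_ord -expRM_natl mulrN1.
set p := \prod_i _; have e0 := expR_gt0 (- n%:R : R); set e := expR _ in e0 *.
have f0 : n`!%:R != 0 :> R by rewrite pnatr_eq0 -lt0n fact_gt0.
have nn : n%:R ^+ n != 0 :> R by rewrite expf_neq0// gt_eqF.
by field; rewrite f0 nn gt_eqF.
Qed.

(** Given S_n = 0 the path is a function of the occupation numbers, which take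
    finitely many values: on [0, 1] the increment of index n, which they do not
    determine, has weight 0 in the interpolation. *)
Lemma bridge_law_integral (F : C01 R -> R) :
  measurable_fun setT (F : borel (C01 R) -> R) -> (exists M, forall x, `|F x| <= M) ->
  (\int[bridge_law Poi n]_x (F x)%:E)%E =
  (mexp (fun v => F (scaled_path (bridge_walk R v) n)))%:E.
Proof.
move=> mF [M FM]; set Q := cond_prob P (measurable_walk0 Poi n).
have mA := measurable_walk0 Poi n.
have mFw : measurable_fun setT (fun w => F (walk_path Poi n w)).
  by apply: (measurableT_comp mF); exact: measurable_walk_path.
rewrite integral_distribution; last first.
- apply: (@integr_bounded _ _ _ Q _ M) => [|w]; first exact: mFw.
  exact: FM.
- exact/measurable_EFinP.
pose c (v : {ffun 'I_n -> 'I_n.+1}) := F (scaled_path (bridge_walk R v) n).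
transitivity (\int[Q]_w (\sum_u c u * \1_(counts_event u) w)%:E)%E; last first.
  rewrite integral_counts; congr EFin; apply: eq_bigr => u _.
  by rewrite mulrC cond_counts.
apply: ae_eq_integral => //.
- exact/measurable_EFinP.
- apply/measurable_EFinP; apply: measurable_sum => u; apply: measurable_funM => //.
  exact: measurable_indic (measurable_counts_event u).
exists (~` A); split; first exact: measurableC.
  by apply: (etrans (cond_probE _)); rewrite setICl measure0 mul0e.
move=> w /= nE Aw; apply: nE => _; congr EFin.
have [v vn wv] := walk0_counts Aw; rewrite (sum_counts_indic _ wv) /c.
congr F; apply/continuousEP => t.
change (scaled_interp (walk Poi ^~ w) n t = scaled_interp (bridge_walk R v) n t).
rewrite /scaled_interp; congr (_ / _).
have /set_mem/= := valP t; rewrite in_itv/= => /andP[t0 t1].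
have x0 : 0 <= n%:R * set_val t by rewrite mulr_ge0.
have xn : n%:R * set_val t < n.+1%:R.
  by rewrite (@le_lt_trans _ _ n%:R) ?ltr_nat// ler_piMr.
have w0 : walk Poi 0 w = 0 by rewrite /walk big_ord0.
have b0 : bridge_walk R v 0 = 0 by rewrite /bridge_walk big1.
rewrite !(interpE _ x0 xn) w0 b0 !add0r.
rewrite !big_ord_recr/=; congr (_ + _); last first.
  rewrite max_l ?mul0r// ge_min; apply/orP; right.
  by rewrite subr_le0 ler_piMr.
apply: eq_bigr => j _; congr (_ * _); rewrite /walk big_ord_recr/= addrAC subrr add0r.
have := bridge_walk_diff R v j 1; rewrite addn1 => ->.
rewrite (bigD1 j)/= ?leqnn ?ltnSn// big1 ?addr0 ?wv// => i.
by rewrite ltnS andbC -eqn_leq eq_sym val_eqE andNb.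
Qed.

End conditional_law.

(** * Functionals on the space of continuous paths *)

Section uniform_distance.
Variable R : realType.
Implicit Types (x y z : C01 R) (F : C01 R -> R).

Definition within_dist (e : R) x y := forall t, `|C01_eval x t - C01_eval y t| <= e.

Lemma C01_ball x y e : ball x e y <-> forall t, `|C01_eval x t - C01_eval y t| < e.
Proof. by []. Qed.

Lemma continuous_C01_dist F x e : continuous F -> 0 < e ->
  exists2 del : R, 0 < del & forall y, within_dist del x y -> `|F x - F y| < e.
Proof.
move=> cF e0; have /cvgrPdist_lt/(_ e e0)/nbhs_ballP[r /= r0 rF] := cF x.
exists (r / 2); first by rewrite divr_gt0.
move=> y xy; apply: rF; apply/C01_ball => t; apply: le_lt_trans (xy t) _; lra.
Qed.

Definition lipschitz_C01 (L : R) F := forall x y e, within_dist e x y -> `|F x - F y| <= L * e.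

Lemma lipschitz_C01_continuous L F : 0 <= L -> lipschitz_C01 L F -> continuous F.
Proof.
move=> L0 FL x; apply/(@cvgrPdist_lt _ _ _ (nbhs (x : C01 R))) => e e0; apply/nbhs_ballP.
have d0 : 0 < e / (L + 1) by apply: divr_gt0 => //; lra.
exists (e / (L + 1)) => //= y /C01_ball xy.
apply: le_lt_trans (FL _ _ (e / (L + 1)) _) _; first by move=> t; exact: ltW.
by rewrite mulrA ltr_pdivrMr; nra.
Qed.

Lemma continuous_C01_measurable F : continuous F ->
  measurable_fun setT (F : borel (C01 R) -> R).
Proof.
move=> cF; apply: (measurability _ (RGenOpens.measurableE R)).
move=> _ [_ [a [b ->] <-]]; rewrite setTI.
apply: sub_sigma_algebra; move/continuousP: cF; apply; exact: interval_open.
Qed.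

Lemma C01_eval_measurable (t : unitI R) :
  measurable_fun setT (fun x : borel (C01 R) => C01_eval (x : C01 R) t).
Proof.
apply: continuous_C01_measurable; apply: (@lipschitz_C01_continuous 1) => // x y e xy.
by rewrite mul1r; exact: xy.
Qed.

Lemma set_val_itv (t : unitI R) : 0 <= set_val t <= 1.
Proof. by have /set_mem/= := valP t; rewrite in_itv/=. Qed.

Lemma C01_unif_continuous x (e : R) : 0 < e ->
  exists2 del : R, 0 < del & forall s t : unitI R,
    `|set_val s - set_val t| < del -> `|C01_eval x s - C01_eval x t| <= e.
Proof.
move=> e0.
(* compactness of [0, 1] in R, for a property that is local in u *)
pose Q (del u : R) := forall s t : unitI R, `|set_val s - u| < del -> `|set_val t - u| < del ->
  `|C01_eval x s - C01_eval x t| <= e.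
have /compact_near_coveringP/(_ R (0 : R)^'+ Q) := @segment_compact R 0 1.
case.
  move=> u u01; have s0P : u \in (`[0, 1]%classic : set R) by apply/mem_set.
  pose s0 : unitI R := SigSub s0P.
  have cx : continuous (C01_eval x) by exact: cts_fun.
  have e20 : 0 < e / 2 by rewrite divr_gt0.
  have /cvgrPdist_lt/(_ _ e20)/nbhs_ballP[r /= r0 rx] := cx s0.
  have {}rx (s : unitI R) : `|set_val s - u| < r -> `|C01_eval x s0 - C01_eval x s| < e / 2.
    by move=> su; apply: rx; change (`|u - set_val s| < r); rewrite distrC.
  near=> u' del => s t su tu.
  have uu' : `|u - u'| < r / 2.
    by near: u'; apply: nbhsx_ballx; rewrite divr_gt0.
  have dr : del < r / 2 by near: del; apply: nbhs_right_lt; rewrite divr_gt0.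
  have hs (s' : unitI R) : `|set_val s' - u'| < del -> `|C01_eval x s0 - C01_eval x s'| < e / 2.
    move=> h; apply: rx; rewrite (_ : _ - u = (set_val s' - u') - (u - u')); last by ring.
    by apply: le_lt_trans (ler_normB _ _) _; lra.
  rewrite (_ : _ - _ = (C01_eval x s0 - C01_eval x t) - (C01_eval x s0 - C01_eval x s)); last by ring.
  apply: le_trans (ler_normB _ _) _; have := hs _ su; have := hs _ tu; lra.
move=> del /= del0 H.
exists (del / 2); first by rewrite divr_gt0.
move=> s t st; apply: (H (del / 2) _ _ (set_val s)).
- rewrite /ball/= sub0r normrN gtr0_norm ?divr_gt0//; lra.
- by rewrite divr_gt0.
- exact: set_val_itv.
- by rewrite subrr normr0 divr_gt0.
- by rewrite distrC.
Unshelve. all: by end_near.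
Qed.

(** The largest minorant of F with Lipschitz constant k, that is the infimum over y
    of F y + k d(x, y). Letting e range over all upper bounds of the distance avoids
    naming the distance itself. *)
Definition envelope F (k : R) x : R :=
  inf [set F ye.1 + k * ye.2 | ye in [set ye : C01 R * R | 0 <= ye.2 /\ within_dist ye.2 x ye.1]].

Section envelope.
Variables (F : C01 R -> R) (M : R).
Hypothesis FM : forall x, `|F x| <= M.

Lemma within_dist0 x : within_dist 0 x x.
Proof. by move=> t; rewrite subrr normr0. Qed.

Let E k x := [set F ye.1 + k * ye.2 | ye in [set ye : C01 R * R | 0 <= ye.2 /\ within_dist ye.2 x ye.1]].

Lemma envelope_lb k x : 0 <= k -> lbound (E k x) (- M).
Proof.
move=> k0 _ [[y e] /= [e0 xy] <-].
have /ler_normlP[h1 h2] := FM y; have := mulr_ge0 k0 e0; lra.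
Qed.

Lemma envelope_le k x y e : 0 <= k -> 0 <= e -> within_dist e x y ->
  envelope F k x <= F y + k * e.
Proof.
move=> k0 e0 xy; apply: ge_inf; first by exists (- M); exact: envelope_lb.
by exists (y, e).
Qed.

Lemma envelope_ge k x c : (forall y e, 0 <= e -> within_dist e x y -> c <= F y + k * e) ->
  c <= envelope F k x.
Proof.
move=> H; apply: lb_le_inf.
  by exists (F x + k * 0), (x, 0) => //=; split => //; exact: within_dist0.
by move=> _ [[y e] /= [e0 xy] <-]; exact: H.
Qed.

Lemma envelope_le_fun k x : 0 <= k -> envelope F k x <= F x.
Proof.
move=> k0; have := @envelope_le k x x 0 k0 (lexx _) (within_dist0 x).
by rewrite mulr0 addr0.
Qed.

Lemma envelope_bounded k x : 0 <= k -> `|envelope F k x| <= M.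
Proof.
move=> k0; rewrite ler_norml; apply/andP; split.
  apply: envelope_ge => y e e0 xy; apply: (@envelope_lb k x k0).
  by exists (y, e).
by apply: le_trans (envelope_le_fun x k0) _; have /ler_normlP[] := FM x.
Qed.

Lemma within_dist_ge0 e x y : within_dist e x y -> 0 <= e.
Proof.
move=> xy; have s0P : (0 : R) \in (`[0, 1]%classic : set R).
  by apply/mem_set; rewrite /= in_itv/= lexx ler01.
exact: le_trans (normr_ge0 _) (xy (SigSub s0P)).
Qed.

Lemma envelope_lipschitz k : 0 <= k -> lipschitz_C01 k (envelope F k).
Proof.
move=> k0; have H x y e : within_dist e x y -> envelope F k x - k * e <= envelope F k y.
  move=> xy; have e0 := within_dist_ge0 xy; apply: envelope_ge => z e' e'0 yz.
  rewrite lerBlDr -addrA -mulrDr; apply: envelope_le => //; first by rewrite addr_ge0.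
  move=> t; rewrite (_ : _ - _ = (C01_eval x t - C01_eval y t) + (C01_eval y t - C01_eval z t)); last by ring.
  by apply: le_trans (ler_normD _ _) _; rewrite addrC lerD.
move=> x y e xy; have h1 := H _ _ _ xy.
have yx : within_dist e y x by move=> t; rewrite distrC; exact: xy.
by have h2 := H _ _ _ yx; rewrite ler_norml; apply/andP; split; lra.
Qed.

(** Points y at distance at most del have F y close to F x; the others are
    penalised by at least k del >= 2 M, the largest possible drop of F. *)
Lemma envelope_cvg x : continuous F -> envelope F k%:R x @[k --> \oo] --> F x.
Proof.
move=> cF; apply/cvgrPdist_le => e e0.
have [del del0 Fdel] := continuous_C01_dist x cF e0.
pose K := (Num.truncn (2 * M / del)).+1.
exists K => //= k Kk; have k0 : 0 <= k%:R :> R by [].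
rewrite ger0_norm; last by rewrite subr_ge0 envelope_le_fun.
rewrite lerBlDr -lerBlDl; apply: envelope_ge => y r r0 xy.
have [rd|dr] := leP r del.
  have : `|F x - F y| < e by apply: Fdel => t; exact: le_trans (xy t) rd.
  have := mulr_ge0 k0 r0; move=> h /ltr_normlP[h1 h2]; lra.
have : 2 * M <= k%:R * r.
  apply: (@le_trans _ _ (k%:R * del)); last by rewrite ler_wpM2l// ltW.
  rewrite -ler_pdivrMr// ltW// (lt_le_trans (truncnS_gt _))// ler_nat//.
have /ler_normlP[h1 h2] := FM x; have /ler_normlP[h3 h4] := FM y; lra.
Qed.

End envelope.
End uniform_distance.

(** * Polygonal approximation of paths *)

Section interpolation.
Variable R : realType.
Implicit Types (s : nat -> R) (x : R).

Lemma interp_near s c B x : 0 <= x -> `|s (Num.truncn x) - c| <= B ->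
  `|s (Num.truncn x).+1 - c| <= B -> `|interp s x - c| <= B.
Proof.
move=> x0; have /andP[f0 f1] := truncn_itv x0; rewrite /interp.
set k := Num.truncn x in f0 f1 * => h1 h2; rewrite -natr1 in f1.
rewrite (_ : _ - c = (1 - (x - k%:R)) * (s k - c) + (x - k%:R) * (s k.+1 - c)); last by ring.
have p1 : 0 <= x - k%:R by lra.
have p2 : 0 <= 1 - (x - k%:R) by lra.
apply: le_trans (ler_normD _ _) _; rewrite !normrM (ger0_norm p1) (ger0_norm p2).
have := ler_wpM2l p1 h2; have := ler_wpM2l p2 h1; lra.
Qed.

Lemma interpZ s c x : interp (fun k => c * s k) x = c * interp s x.
Proof. by rewrite /interp; ring. Qed.

Lemma interpB s s' x : interp s x - interp s' x = interp (fun k => s k - s' k) x.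
Proof. by rewrite /interp; ring. Qed.

Lemma to_unitI_proof (u : R) : Num.max 0 (Num.min 1 u) \in (`[0, 1]%classic : set R).
Proof. by apply/mem_set; rewrite /= in_itv/= le_max lexx/= ge_max ler01 ge_min lexx. Qed.

Definition to_unitI (u : R) : unitI R := SigSub (to_unitI_proof u).

Lemma to_unitIE u : 0 <= u <= 1 -> set_val (to_unitI u) = u.
Proof.
move=> /andP[u0 u1]; rewrite [LHS](_ : _ = Num.max 0 (Num.min 1 u))//.
by rewrite min_r// max_r.
Qed.

Variable m : nat.
Hypothesis m_gt0 : (0 < m)%N.

Definition node (i : nat) : R := (minn i m)%:R / m%:R.

Lemma node_itv i : 0 <= node i <= 1.
Proof.
have m0 : 0 < m%:R :> R by rewrite ltr0n.
by rewrite /node divr_ge0//= ler_pdivrMr// mul1r ler_nat geq_minr.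
Qed.

(** The index is capped at m because the interpolation at the end point 1 mentions
    the step m + 1, with weight 0. The factor sqrt m cancels the scaling of paths. *)
Definition polygonal (y : 'I_m.+1 -> R) : C01 R :=
  scaled_path (fun i => Num.sqrt m%:R * y (inord (minn i m))) m.

Definition sample (x : C01 R) (i : 'I_m.+1) : R := C01_eval x (to_unitI (node i)).

Lemma polygonal_eval (y : 'I_m.+1 -> R) t :
  C01_eval (polygonal y) t = interp (fun i => y (inord (minn i m))) (m%:R * set_val t).
Proof.
rewrite /polygonal scaled_pathE interpZ mulrC mulKf// gt_eqF// sqrtr_gt0.
by rewrite ltr0n.
Qed.

Lemma polygonal_lipschitz (y y' : 'I_m.+1 -> R) :
  within_dist (\sum_i `|y i - y' i|) (polygonal y) (polygonal y').
Proof.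
move=> t; rewrite !polygonal_eval interpB -[X in `|X|]subr0.
have b i : `|y i - y' i| <= \sum_i `|y i - y' i|.
  by rewrite (bigD1 i)//= lerDl; apply: sumr_ge0.
apply: interp_near; rewrite ?subr0//.
by rewrite mulr_ge0//; have /andP[] := set_val_itv t.
Qed.

Lemma inord_minn i : (inord (minn i m) : 'I_m.+1) = minn i m :> nat.
Proof. by rewrite inordK// ltnS geq_minr. Qed.

Lemma node_minn i : node (minn i m) = node i.
Proof. by rewrite /node -minnA minnn. Qed.

Lemma polygonal_sample_near (x : C01 R) e :
  (forall s t : unitI R, `|set_val s - set_val t| <= m%:R^-1 ->
    `|C01_eval x s - C01_eval x t| <= e) ->
  within_dist e (polygonal (sample x)) x.
Proof.
move=> xe t; rewrite polygonal_eval.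
have m0 : 0 < m%:R :> R by rewrite ltr0n.
have /andP[t0 t1] := set_val_itv t.
have mt0 : 0 <= m%:R * set_val t by rewrite mulr_ge0.
have /andP[k0 k1] := truncn_itv mt0; set k := Num.truncn _ in k0 k1 *.
have mtm : m%:R * set_val t <= m%:R by rewrite ler_piMr.
have km : (k <= m)%N by rewrite -(ler_nat R); lra.
have H (j : nat) : `|(minn j m)%:R - m%:R * set_val t| <= 1 ->
    `|sample x (inord (minn j m)) - C01_eval x t| <= e.
  move=> jt; apply: xe; rewrite to_unitIE ?node_itv// inord_minn node_minn /node.
  rewrite (_ : _ - _ = ((minn j m)%:R - m%:R * set_val t) * m%:R^-1); last by field; lra.
  by rewrite normrM [X in _ * X]gtr0_norm ?invr_gt0// ler_piMl// invr_ge0.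
rewrite -natr1 in k1.
apply: interp_near => //; apply: H.
  by rewrite (minn_idPl km) -/k ler_norml; apply/andP; split; lra.
rewrite -/k; have [km'|mk] := ltnP k m.
  by rewrite (minn_idPl km') -natr1 ler_norml; apply/andP; split; lra.
have -> : minn k.+1 m = m by apply/minn_idPr; rewrite leqW.
have : m%:R <= k%:R :> R by rewrite ler_nat.
by move=> ?; rewrite ler_norml; apply/andP; split; lra.
Qed.

End interpolation.
Arguments sample {R} m x i.
Arguments polygonal {R} m y.

Section tightness.
Variables (R : realType) (n m : nat).
Hypothesis m_gt0 : (0 < m)%N.
Hypothesis mn : (m <= n)%N.
Implicit Types v : {ffun 'I_n -> 'I_n.+1}.

Let n_gt0 : (0 < n)%N. Proof. exact: leq_trans mn. Qed.

Local Notation S v := (bridge_walk R v).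
Local Notation Sosc := (osc (fun k v => bridge_walk R v k)).

Definition walk_path_of v : C01 R := scaled_path (S v) n.

Lemma walk_path_of_eval v t : C01_eval (walk_path_of v) t = bridge_path v (set_val t).
Proof. by []. Qed.

Definition block_start (l : nat) := Num.truncn (n%:R * (l%:R / m%:R) : R).
Definition block_size (l : nat) := ((block_start l.+1).+1 - block_start l)%N.

Lemma block_osc v l (u : R) : l%:R / m%:R <= u <= l.+1%:R / m%:R ->
  `|interp (S v) (n%:R * u) - S v (block_start l)| <= Sosc (block_start l) (block_size l) v.
Proof.
move=> /andP[lu ul].
have m0 : 0 < m%:R :> R by rewrite ltr0n.
have x0 : 0 <= n%:R * (l%:R / m%:R) :> R by rewrite mulr_ge0// divr_ge0.
have x1 : n%:R * (l%:R / m%:R) <= n%:R * u by rewrite ler_wpM2l.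
have x2 : n%:R * u <= n%:R * (l.+1%:R / m%:R) by rewrite ler_wpM2l.
have t1 : (block_start l <= Num.truncn (n%:R * u))%N by apply: le_truncn.
have t2 : (Num.truncn (n%:R * u) <= block_start l.+1)%N by apply: le_truncn.
have o k : (block_start l <= k)%N -> (k <= (block_start l.+1).+1)%N ->
    `|S v k - S v (block_start l)| <= Sosc (block_start l) (block_size l) v.
  move=> k1 k2; have := @le_osc R n (fun k v => S v k) (block_start l) (block_size l) (k - block_start l) v.
  by rewrite subnKC//; apply; rewrite leq_sub2r.
apply: interp_near; first exact: le_trans x0 x1.
  by apply: o => //; rewrite leqW.
by apply: o => //; rewrite leqW.
Qed.

(** Rounding adds at most 2 steps, and 2 <= 2 n / m. *)
Lemma block_size_le l : (block_size l)%:R <= 3 * (n%:R / m%:R) :> R.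
Proof.
have m0 : 0 < m%:R :> R by rewrite ltr0n.
have x0 k : 0 <= n%:R * (k%:R / m%:R) :> R by rewrite mulr_ge0// divr_ge0.
have /andP[a1 a2] := truncn_itv (x0 l); have /andP[b1 b2] := truncn_itv (x0 l.+1).
rewrite -/(block_start l) -/(block_start l.+1) in a1 a2 b1 b2.
have nm : 1 <= n%:R / m%:R :> R by rewrite ler_pdivlMr// mul1r ler_nat.
have h : (block_size l)%:R <= (block_start l.+1).+1%:R - (block_start l)%:R :> R.
  rewrite /block_size natrB// ltnW// ltnS; apply: le_truncn.
  by rewrite ler_wpM2l// ler_pM2r ?invr_gt0// ler_nat.
rewrite -natr1 in a2; rewrite -natr1 in h.
have e : n%:R * (l.+1%:R / m%:R) = n%:R * (l%:R / m%:R) + n%:R / m%:R :> R.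
  by rewrite -natr1; field; lra.
lra.
Qed.

(** Each block oscillation a satisfies a <= del + a^4 / del^3; summing over blocks
    replaces the maximum over blocks by something whose mean follows from the
    maximal inequality. *)
Definition sample_error (del : R) v : R :=
  del + \sum_(l < m) (2 * Sosc (block_start l) (block_size l) v / Num.sqrt n%:R) ^+ 4 / del ^+ 3.

Lemma le_young4 (del a : R) : 0 < del -> 0 <= a -> a <= del + a ^+ 4 / del ^+ 3.
Proof.
move=> d0 a0; have [ad|da] := leP a del.
  by apply: le_trans ad _; rewrite lerDl divr_ge0// exprn_ge0// ltW.
apply: (@le_trans _ _ (a ^+ 4 / del ^+ 3)); last by rewrite lerDr ltW.
rewrite ler_pdivlMr ?exprn_gt0// [X in _ <= X]exprS ler_wpM2l//.
by rewrite lerXn2r ?nnegrE// ltW.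
Qed.

(** On the k-th block, both the path and its chord stay within one block
    oscillation of the value at the start of the block. *)
Lemma sample_error_dist del v : 0 < del ->
  within_dist (sample_error del v) (walk_path_of v) (polygonal m (sample m (walk_path_of v))).
Proof.
move=> d0 t; rewrite polygonal_eval//.
have m0 : 0 < m%:R :> R by rewrite ltr0n.
have nn : 0 < n%:R :> R by rewrite ltr0n.
have q0 : 0 < Num.sqrt n%:R :> R by rewrite sqrtr_gt0.
have /andP[t0 t1] := set_val_itv t.
have mt0 : 0 <= m%:R * set_val t by rewrite mulr_ge0.
have mtm : m%:R * set_val t <= m%:R by rewrite ler_piMr.
have /andP[k0 k1] := truncn_itv mt0; set k := Num.truncn _ in k0 k1.
have km : (k <= m)%N by rewrite -(ler_nat R); lra.
have term0 (l : 'I_m) : 0 <= (2 * Sosc (block_start l) (block_size l) v / Num.sqrt n%:R) ^+ 4 / del ^+ 3.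
  by apply: divr_ge0; [exact: exprn_even_ge0|apply/exprn_ge0/ltW].
have err0 : 0 <= sample_error del v.
  by apply: addr_ge0; [exact: ltW|apply: sumr_ge0 => l _].
(* k = m happens only at t = 1, where the polygonal line meets the path *)
have [km'|mk] := ltnP k m; last first.
  have km2 : k = m by apply/eqP; rewrite eqn_leq km.
  have t1' : m%:R * set_val t = m%:R by apply/eqP; rewrite eq_le mtm -{1}km2.
  have tt : set_val t = 1 by apply: (mulfI (lt0r_neq0 m0)); rewrite t1' mulr1.
  rewrite /interp -/k t1' km2 subrr mul0r addr0 /sample.
  rewrite (_ : to_unitI _ = t) ?subrr ?normr0//; apply/val_inj.
  rewrite [LHS]to_unitIE ?node_itv// inord_minn// minnn /node minnn divff ?gt_eqF//.
pose a := 2 * Sosc (block_start k) (block_size k) v / Num.sqrt n%:R.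
have a0 : 0 <= a by rewrite divr_ge0// mulr_ge0// osc_ge0.
apply: (@le_trans _ _ a); last first.
  apply: le_trans (le_young4 d0 a0) _; rewrite /sample_error lerD2l.
  rewrite (bigD1 (Ordinal km'))//= lerDl; apply: sumr_ge0 => l _; exact: term0.
have pt (u : R) : k%:R / m%:R <= u <= k.+1%:R / m%:R ->
    `|bridge_path v u - S v (block_start k) / Num.sqrt n%:R| <= a / 2.
  move=> /(block_osc v) h; rewrite /bridge_path -mulrBl normrM [X in _ * X]gtr0_norm ?invr_gt0//.
  have -> : a / 2 = Sosc (block_start k) (block_size k) v / Num.sqrt n%:R by rewrite /a; field; lra.
  by rewrite ler_wpM2r// ltW// invr_gt0.
rewrite (_ : _ - _ = (C01_eval (walk_path_of v) t - S v (block_start k) / Num.sqrt n%:R) -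
  (interp (fun i => sample m (walk_path_of v) (inord (minn i m))) (m%:R * set_val t) -
   S v (block_start k) / Num.sqrt n%:R)); last by ring.
rewrite [leRHS]splitr; apply: le_trans (ler_normB _ _) _; apply: lerD.
  by rewrite walk_path_of_eval; apply: pt; rewrite ler_pdivrMr// ler_pdivlMr// ![set_val t * _]mulrC k0 ltW.
have kk : k%:R / m%:R <= k.+1%:R / m%:R :> R by rewrite ler_pM2r ?invr_gt0// ler_nat.
have nodeE j : (j <= m)%N -> set_val (to_unitI (node R m (inord (minn j m) : 'I_m.+1))) = j%:R / m%:R.
  move=> jm; rewrite to_unitIE ?node_itv// inord_minn node_minn /node.
  by rewrite (minn_idPl jm).
apply: interp_near => //; rewrite -/k /sample walk_path_of_eval nodeE//; apply: pt; rewrite lexx.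
  by rewrite kk.
by rewrite kk.
Qed.

Lemma mexp_sample_error del : 0 < del ->
  mexp (sample_error del) <= del + 144 * maximal_constant R / (m%:R * del ^+ 3).
Proof.
move=> d0; have m0 : 0 < m%:R :> R by rewrite ltr0n.
have nn : 0 < n%:R :> R by rewrite ltr0n.
have q0 : 0 < Num.sqrt n%:R :> R by rewrite sqrtr_gt0.
have q2 : Num.sqrt n%:R ^+ 2 = n%:R :> R by rewrite sqr_sqrtr.
have d30 : 0 < del ^+ 3 by rewrite exprn_gt0.
have -> : sample_error del = (fun v => del +
    \sum_(l < m) (16 / (n%:R ^+ 2 * del ^+ 3)) * Sosc (block_start l) (block_size l) v ^+ 4).
  apply/funext => v; congr (_ + _); apply: eq_bigr => l _.
  have -> : n%:R ^+ 2 = Num.sqrt n%:R ^+ 4 :> R by rewrite -{1}q2 -exprM.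
  by field; lra.
rewrite mexpD mexp_cst// lerD2l mexp_sum.
have K0 : 0 <= maximal_constant R by rewrite /maximal_constant !mulr_ge0// exprn_ge0.
apply: (@le_trans _ _ (\sum_(l < m) (144 * maximal_constant R / (m%:R ^+ 2 * del ^+ 3)))); last first.
  by rewrite sumr_const card_ord -[_ *+ m]mulr_natr le_eqVlt; apply/orP; left; apply/eqP; field; lra.
apply: ler_sum => l _; rewrite mexpZ.
have h := bridge_maximal_inequality R n_gt0 (block_start l) (block_size l).
have h2 : (block_size l)%:R ^+ 2 <= (3 * (n%:R / m%:R)) ^+ 2 :> R.
  by rewrite lerXn2r ?nnegrE ?block_size_le// mulr_ge0// divr_ge0.
have c0 : 0 <= 16 / (n%:R ^+ 2 * del ^+ 3) by rewrite divr_ge0// mulr_ge0 ?sqr_ge0// ltW.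
apply: le_trans (ler_wpM2l c0 (le_trans h (ler_wpM2l K0 h2))) _.
by rewrite le_eqVlt; apply/orP; left; apply/eqP; field; lra.
Qed.

(** The bound does not depend on n, and its second term tends to 0 as m grows. *)
Lemma mexp_polygonal (F : C01 R -> R) L del : 0 <= L -> lipschitz_C01 L F -> 0 < del ->
  `|mexp (fun v => F (walk_path_of v)) - mexp (fun v => F (polygonal m (sample m (walk_path_of v))))|
  <= L * (del + 144 * maximal_constant R / (m%:R * del ^+ 3)).
Proof.
move=> L0 FL d0; rewrite -mexpB; apply: le_trans (mexp_norm _) _.
apply: (@le_trans _ _ (mexp (fun v => L * sample_error del v))).
  by apply: mexp_le => v; apply: FL; exact: sample_error_dist.
by rewrite mexpZ ler_wpM2l// mexp_sample_error.
Qed.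

End tightness.

(** * Convergence to the Brownian bridge *)

Section bounded_convergence.
Context d (T : measurableType d) (R : realType) (P : probability T R).

Lemma bounded_cvg_Rintegral (h_ : nat -> T -> R) (h : T -> R) M :
  (forall k, measurable_fun setT (h_ k)) -> (forall k w, `|h_ k w| <= M) ->
  (forall w, h_ k w @[k --> \oo] --> h w) ->
  \int[P]_w h_ k w @[k --> \oo] --> \int[P]_w h w.
Proof.
move=> mh hM hc.
have mhl : measurable_fun setT h by apply: (measurable_fun_cvg mh) => w _; exact: hc.
have hlM w : `|h w| <= M.
  have cn : `|h_ k w| @[k --> \oo] --> `|h w| by apply: cvg_norm; exact: hc.
  rewrite -(cvg_lim (@Rhausdorff R) cn); apply: limr_le; first exact: cvgP cn.
  exact: nearW.
have ih := integr_bounded P mhl hlM.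
have mhk k : measurable_fun setT (EFin \o h_ k) by exact/measurable_EFinP.
have mhl' : measurable_fun setT (EFin \o h) by exact/measurable_EFinP.
have hc' : {ae P, forall w, [set: T] w -> (EFin \o h_ k) w @[k --> \oo] --> (EFin \o h) w}.
  by apply: aeW => w _; apply: cvg_EFin; [exact: nearW|exact: hc].
have iM : integr P (fun=> M) := integr_cst P M.
have bnd : {ae P, forall w k, [set: T] w -> (`|(EFin \o h_ k) w| <= (EFin \o cst M) w)%E}.
  by apply: aeW => w k _; rewrite /= lee_fin.
have [_ _ H] := dominated_convergence measurableT mhk mhl' hc' iM bnd.
apply: fine_cvg; rewrite fineK //; exact: integrable_fin_num.
Qed.

End bounded_convergence.

Section bridge_gaussian.
Context d (T : measurableType d) (R : realType) (P : probability T R).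
Variable b : {RV P >-> borel (C01 R)}.
Hypothesis b_bridge : brownian_bridge b.
Local Notation bt t := (fun w => C01_eval (b w) t).

Lemma bridge_measurable t : measurable_fun setT (bt t).
Proof. exact: (measurableT_comp (C01_eval_measurable t)). Qed.

Lemma bridge_coord_mgf t : exists m s : R, forall eta,
   (\int[P]_w (expR (eta * bt t w))%:E = (expR (eta * m + eta ^+ 2 * s ^+ 2 / 2))%:E)%E.
Proof.
have [gp _ _] := b_bridge; apply: is_gaussian_mgf; first exact: bridge_measurable.
have := gp 1%N (fun=> 1) (fun=> t); congr is_gaussian.
by apply/funext => w; rewrite big_ord1 mul1r.
Qed.

Lemma bridge_integr t : integr P (bt t).
Proof.
have [m [s mgf]] := bridge_coord_mgf t.
exact: (mgf_integr_X (bridge_measurable t) mgf).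
Qed.

Lemma bridge_integr_sqr t : integr P (fun w => bt t w ^+ 2).
Proof.
have [m [s mgf]] := bridge_coord_mgf t.
exact: (mgf_integr_X2 (bridge_measurable t) mgf).
Qed.

Lemma bridge_integrM s t : integr P (fun w => bt s w * bt t w).
Proof.
apply: (@integr_dom _ _ _ _ _ (fun w => bt s w ^+ 2 + bt t w ^+ 2)).
- by apply: measurable_funM; exact: bridge_measurable.
- move=> w; have h (x y : R) : `|x * y| <= x ^+ 2 + y ^+ 2.
    have := sqr_ge0 (x + y); have := sqr_ge0 (x - y); have := sqr_ge0 x; have := sqr_ge0 y.
    by rewrite ler_norml !expr2 => *; apply/andP; split; lra.
  exact: h.
- by apply: integrD; exact: bridge_integr_sqr.
Qed.

Lemma bridge_mean t : \int[P]_w bt t w = 0.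
Proof. by have [_ /(_ t) + _] := b_bridge; rewrite unlock /Rintegral => ->. Qed.

Lemma bridge_covariance s t : \int[P]_w (bt s w * bt t w) =
  Num.min (set_val s) (set_val t) - set_val s * set_val t.
Proof.
wlog st : s t / set_val s <= set_val t => [H|].
  have [st|ts] := leP (set_val s) (set_val t); first by rewrite H// min_l.
  under eq_Rintegral do rewrite mulrC.
  by rewrite H ?(ltW ts)// min_l ?(ltW ts)// mulrC.
have [_ b0 /(_ s t st)] := b_bridge; rewrite min_l//.
rewrite unlock !b0 /= unlock => H.
transitivity (fine (set_val s * (1 - set_val t))%:E); last by rewrite /=; ring.
rewrite -H; congr fine; apply: eq_integral => w _; congr EFin.
change (bt s w * bt t w = (bt s w - 0) * (bt t w - 0)); by rewrite !subr0.
Qed.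

(** The linear combination is Gaussian with unknown parameters, which its mean and
    its second moment determine. *)
Lemma bridge_mgf k (a : 'I_k -> R) (t : 'I_k -> unitI R) :
  integr P (fun w => expR (\sum_i a i * bt (t i) w)) /\
  \int[P]_w expR (\sum_i a i * bt (t i) w) =
  expR ((\sum_i \sum_i' a i * a i' *
    (Num.min (set_val (t i)) (set_val (t i')) - set_val (t i) * set_val (t i'))) / 2).
Proof.
have [gp _ _] := b_bridge.
pose X w := \sum_i a i * bt (t i) w.
have mX : measurable_fun setT X.
  by apply: measurable_sum => i; apply: measurable_funM => //; exact: bridge_measurable.
have [m [s mgf]] := is_gaussian_mgf mX (gp k a t).
have EX : \int[P]_w X w = 0.
  rewrite Rintegral_sumT => [|i]; last exact/integrZ/bridge_integr.
  by apply: big1 => i _; rewrite RintegralZl ?bridge_mean ?mulr0//; exact: bridge_integr.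
have EX2 : \int[P]_w (X w ^+ 2) = \sum_i \sum_i' a i * a i' *
    (Num.min (set_val (t i)) (set_val (t i')) - set_val (t i) * set_val (t i')).
  transitivity (\int[P]_w (\sum_i \sum_i' (a i * a i') * (bt (t i) w * bt (t i') w))).
    apply: eq_Rintegral => w _; rewrite expr2 /X big_distrl/=; apply: eq_bigr => i _.
    by rewrite big_distrr/=; apply: eq_bigr => i' _; ring.
  have ii i i' : integr P (fun w => (a i * a i') * (bt (t i) w * bt (t i') w)).
    by apply: integrZ; exact: bridge_integrM.
  rewrite Rintegral_sumT => [|i]; last by apply: integr_sum => i'; exact: ii.
  apply: eq_bigr => i _; rewrite Rintegral_sumT//; apply: eq_bigr => i' _.
  by rewrite RintegralZl ?bridge_covariance//; exact: bridge_integrM.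
have m0 := mgf_mean mX mgf EX.
have s2 := mgf_variance mX mgf EX EX2.
have E1 : (fun w => expR (1 * X w)) = (fun w => expR (X w)) by apply/funext => w; rewrite mul1r.
split; first by have := mgf_integr mX mgf 1; rewrite E1.
have := mgf_Rintegral mgf 1; rewrite E1 => ->.
by rewrite m0 s2 mulr0 add0r expr1n mul1r.
Qed.

Section finite_dimensional.
Variables (k : nat) (t : 'I_k -> unitI R).
Implicit Types (h g w : ('I_k -> R) -> R) (a : 'I_k -> R).

Let Y (om : T) (i : 'I_k) : R := bt (t i) om.
Definition path_coords n (v : {ffun 'I_n -> 'I_n.+1}) (i : 'I_k) : R :=
  bridge_path v (set_val (t i)).

Definition fd_mean h (n : nat) : R :=
  mexp (fun v : {ffun 'I_n -> 'I_n.+1} => h (path_coords v)).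

(** The expectations of h under the finite-dimensional laws converge. This class
    of functions is enlarged step by step, from exponentials to all Lipschitz
    functions. *)
Definition fd_cvg h := integr P (fun om => h (Y om)) /\
  fd_mean h n @[n --> \oo] --> \int[P]_om h (Y om).

Lemma fd_cvg_exp a : fd_cvg (fun x => expR (\sum_i a i * x i)).
Proof.
have [ie ee] := bridge_mgf a t; split=> //; rewrite [X in _ --> X]ee.
by apply: bridge_mgf_cvg => i; exact: set_val_itv.
Qed.

Lemma fd_cvgD h g : fd_cvg h -> fd_cvg g -> fd_cvg (fun x => h x + g x).
Proof.
move=> [ih hc] [ig gc]; split; first exact: integrD.
rewrite RintegralD// (_ : fd_mean _ = (fun n => fd_mean h n + fd_mean g n)).
  exact: cvgD.
by apply/funext => n; exact: mexpD.
Qed.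

Lemma fd_cvgZ c h : fd_cvg h -> fd_cvg (fun x => c * h x).
Proof.
move=> [ih hc]; split; first exact: integrZ.
rewrite RintegralZl// (_ : fd_mean _ = (fun n => c * fd_mean h n)).
  by apply: cvgM => //; exact: cvg_cst.
by apply/funext => n; exact: mexpZ.
Qed.

Lemma fd_cvg_cst c : fd_cvg (fun=> c).
Proof.
have := fd_cvgZ c (fd_cvg_exp (fun=> 0)).
congr fd_cvg; apply/funext => x.
by rewrite big1 ?expR0 ?mulr1// => i _; rewrite mul0r.
Qed.

Lemma fd_cvg_sum (I : Type) (r : seq I) (h : I -> ('I_k -> R) -> R) :
  (forall i, fd_cvg (h i)) -> fd_cvg (fun x => \sum_(i <- r) h i x).
Proof.
move=> hc; elim: r => [|i r IH].
  by under eq_fun do rewrite big_nil; exact: fd_cvg_cst.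
by under eq_fun do rewrite big_cons; exact: fd_cvgD.
Qed.

(** The means of the weight w converge, so that they are bounded, and errors
    dominated by e w have small means uniformly in n. *)
Lemma fd_cvg_approx h w : measurable_fun setT (fun om => h (Y om)) ->
  fd_cvg w -> (forall x, 0 <= w x) ->
  (forall e, 0 < e -> exists2 q, fd_cvg q & forall x, `|h x - q x| <= e * w x) ->
  fd_cvg h.
Proof.
move=> mh [iw wc] w0 happ.
have ih : integr P (fun om => h (Y om)).
  have [q [iq _] hq] := happ 1 ltr01.
  apply: (@integr_dom _ _ _ _ _ (fun om => `|q (Y om)| + w (Y om))) => //.
    move=> om; have := hq (Y om); rewrite mul1r => hq'.
    rewrite -[X in `|X|](subrK (q (Y om))); apply: le_trans (ler_normD _ _) _.
    by rewrite addrC lerD2l.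
  by apply: integrD => //; exact: integrable_norm.
split => //; apply/cvgrPdist_le => e e0.
set W := \int[P]_om w (Y om) in wc.
have W0 : 0 <= W by apply: Rintegral_ge0.
pose e' := e / (2 * (2 * W + 2)).
have e'0 : 0 < e' by apply: divr_gt0 => //; lra.
have [q [iq qc] hq] := happ e' e'0.
have e20 : 0 < e / 2 by rewrite divr_gt0.
have E1 : `|\int[P]_om h (Y om) - \int[P]_om q (Y om)| <= e' * W.
  rewrite -RintegralB// /W -RintegralZl//; apply: le_Rintegral_norm.
  - exact: integrB.
  - exact: integrZ.
  - by move=> om; exact: hq.
have /cvgrPdist_le/(_ _ e20) nq := qc.
have /cvgrPdist_le/(_ 1 ltr01) nw := wc.
near=> n.
have /ler_normlP[q1 q2] : `|\int[P]_om q (Y om) - fd_mean q n| <= e / 2 by near: n.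
have /ler_normlP[w1 w2] : `|W - fd_mean w n| <= 1 by near: n.
have E2 : `|fd_mean h n - fd_mean q n| <= e' * fd_mean w n.
  rewrite /fd_mean -mexpB -mexpZ; apply: le_trans (mexp_norm _) _.
  by apply: mexp_le => v; exact: hq.
have E3 : e' * fd_mean w n <= e' * (W + 1) by rewrite ler_wpM2l ?(ltW e'0)//; lra.
have E4 : e' * W + e' * (W + 1) <= e / 2.
  rewrite -mulrDr /e' mulrAC ler_pdivrMr; nra.
move: E1 E2 => /ler_normlP[a1 a2] /ler_normlP[b1 b2].
rewrite ler_norml; apply/andP; split; lra.
Unshelve. all: by end_near.
Qed.

Lemma coords_measurable a : measurable_fun setT (fun om => \sum_i a i * Y om i).
Proof.
by apply: measurable_sum => i; apply: measurable_funM => //; exact: bridge_measurable.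
Qed.

Lemma fd_cvg_cos a phi : fd_cvg (fun x => cos (\sum_i a i * x i + phi)).
Proof.
have fe c : fd_cvg (fun x => expR (c * \sum_i a i * x i)).
  have := fd_cvg_exp (fun i => c * a i); congr fd_cvg; apply/funext => x.
  by congr expR; rewrite big_distrr/=; apply: eq_bigr => i _; rewrite mulrA.
apply: (@fd_cvg_approx _ (fun x => expR (3 * \sum_i a i * x i) + expR (- 3 * \sum_i a i * x i))).
- apply: (measurableT_comp (continuous_measurable_fun (@continuous_cos R))).
  by apply: measurable_funD => //; exact: coords_measurable.
- exact: fd_cvgD.
- by move=> x; rewrite addr_ge0 ?expR_ge0.
move=> e e0; have [s sa] := cos_exp_approx phi e0.
exists (fun x => \sum_(c <- s) c.1 * expR (c.2 * \sum_i a i * x i)).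
  by apply: fd_cvg_sum => c; apply: fd_cvgZ.
by move=> x; rewrite mulNr; exact: sa.
Qed.

(** The weight 1 + sum_i x_i^2 of trig_approximation is at most a sum of
    exponentials, which is in the class. *)
Lemma fd_cvg_lipschitz g L : 0 <= L ->
  (forall x y, `|g x - g y| <= L * \sum_i `|x i - y i|) ->
  measurable_fun setT (fun om => g (Y om)) -> fd_cvg g.
Proof.
move=> L0 gL mg.
pose w (x : 'I_k -> R) := 1 + \sum_i 4 * (expR (x i) + expR (- x i)).
have fx c i : fd_cvg (fun x => expR (c * x i)).
  have := fd_cvg_exp (fun j => if j == i then c else 0); congr fd_cvg.
  apply/funext => x; rewrite (bigD1 i)//= eqxx big1 ?addr0// => j /negbTE ->.
  by rewrite mul0r.
apply: (@fd_cvg_approx _ w) => //.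
- apply: fd_cvgD; first exact: fd_cvg_cst.
  apply: fd_cvg_sum => i; apply: fd_cvgZ; apply: fd_cvgD.
    by have := fx 1 i; congr fd_cvg; apply/funext => x; rewrite mul1r.
  by have := fx (- 1) i; congr fd_cvg; apply/funext => x; rewrite mulN1r.
- move=> x; apply: addr_ge0 => //; apply: sumr_ge0 => i _.
  by apply: mulr_ge0 => //; apply: addr_ge0; exact: expR_ge0.
move=> e e0; have [p [s ps] gp] := trig_approximation gL L0 e0.
exists p.
  have -> : p = (fun x => \sum_(c <- s) c.1.1 * cos (\sum_i c.1.2 i * x i + c.2)).
    exact/funext.
  by apply: fd_cvg_sum => c; apply: fd_cvgZ; exact: fd_cvg_cos.
move=> x; apply: le_trans (gp x) _; apply: ler_wpM2l; first exact: ltW.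
rewrite lerD2l; apply: ler_sum => i _; apply: le_trans (sqr_le_expR _) _.
rewrite ler_wpM2l//; have := @expR_norm_le R 1 (x i) ler01.
by rewrite !mul1r.
Qed.

End finite_dimensional.

Local Notation path n v := (scaled_path (bridge_walk R v) n : C01 R).

Lemma fd_cvg_polygonal (F : C01 R -> R) L m : (0 < m)%N -> 0 <= L -> lipschitz_C01 L F ->
  mexp (fun v : {ffun 'I_n -> 'I_n.+1} => F (polygonal m (sample m (path n v)))) @[n --> \oo] -->
  \int[P]_w F (polygonal m (sample m (b w))).
Proof.
move=> m0 L0 FL.
pose g (y : 'I_m.+1 -> R) := F (polygonal m y).
have gL y y' : `|g y - g y'| <= L * \sum_i `|y i - y' i| by apply: FL; exact: polygonal_lipschitz.
pose t (i : 'I_m.+1) := to_unitI (node R m i).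
have := @fd_cvg_lipschitz _ t g L L0 gL; case => //.
apply: (measurableT_comp (f := fun x : borel (C01 R) => F (polygonal m (sample m (x : C01 R))))) => //.
apply: (@continuous_C01_measurable _ (fun x => F (polygonal m (sample m x)))).
apply: (@lipschitz_C01_continuous _ (L * m.+1%:R)); first by rewrite mulr_ge0.
move=> x y e xy; apply: le_trans (gL _ _) _; rewrite -mulrA ler_wpM2l//.
apply: (@le_trans _ _ (\sum_(i < m.+1) e)); first by apply: ler_sum => i _; exact: xy.
by rewrite sumr_const card_ord mulr_natl.
Qed.

(** The paths of b are uniformly continuous, so the polygonal lines converge to
    them pathwise. *)
Lemma polygonal_limit (F : C01 R -> R) L M : 0 <= L -> lipschitz_C01 L F ->
  (forall x, `|F x| <= M) ->
  \int[P]_w F (polygonal m.+1 (sample m.+1 (b w))) @[m --> \oo] --> \int[P]_w F (b w).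
Proof.
move=> L0 FL FM; apply: (@bounded_cvg_Rintegral _ _ _ _ _ _ M) => [m|m w|w] //.
  apply: (measurableT_comp (f := fun x : borel (C01 R) => F (polygonal m.+1 (sample m.+1 (x : C01 R))))) => //.
  apply: (@continuous_C01_measurable _ (fun x => F (polygonal m.+1 (sample m.+1 x)))).
  apply: (@lipschitz_C01_continuous _ (L * m.+2%:R)); first by rewrite mulr_ge0.
  move=> x y e xy; apply: le_trans (FL _ _ _ (polygonal_lipschitz (ltn0Sn m) _ _)) _.
  rewrite -mulrA ler_wpM2l//.
  apply: (@le_trans _ _ (\sum_(i < m.+2) e)); first by apply: ler_sum => i _; exact: xy.
  by rewrite sumr_const card_ord mulr_natl.
apply/cvgrPdist_le => e e0.
have e1 : 0 < e / (L + 1) by apply: divr_gt0 => //; lra.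
have [del del0 bdel] := C01_unif_continuous (b w) e1.
exists (Num.truncn (del^-1)) => //= m mN.
rewrite distrC; apply: le_trans (FL _ _ (e / (L + 1)) _) _; last first.
  by rewrite mulrA ler_pdivrMr; nra.
apply: polygonal_sample_near => // s t st; apply: bdel; apply: le_lt_trans st _.
rewrite -[ltRHS]invrK ltf_pV2 ?posrE ?ltr0n ?invr_gt0//.
by apply: lt_le_trans (truncnS_gt _) _; rewrite ler_nat.
Qed.

(** In mexp_polygonal, del is chosen first, then m, and n tends to infinity
    last. *)
Lemma lipschitz_limit (F : C01 R -> R) L M : 0 <= L -> lipschitz_C01 L F ->
  (forall x, `|F x| <= M) ->
  mexp (fun v : {ffun 'I_n -> 'I_n.+1} => F (path n v)) @[n --> \oo] --> \int[P]_w F (b w).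
Proof.
move=> L0 FL FM; apply/cvgrPdist_le => e e0.
have K0 : 0 <= maximal_constant R by rewrite /maximal_constant !mulr_ge0// exprn_ge0.
have e4 : 0 < e / 4 by rewrite divr_gt0.
pose del := e / (4 * (L + 1)).
have del0 : 0 < del by apply: divr_gt0 => //; lra.
have Ldel : L * del <= e / 4.
  by rewrite /del mulrA ler_pdivrMr; nra.
have cL := polygonal_limit L0 FL FM.
have /cvgrPdist_le/(_ _ e4)[m1 _ hm1] := cL.
pose c := L * (144 * maximal_constant R / del ^+ 3).
have c0 : 0 <= c.
  apply: mulr_ge0 => //; apply: divr_ge0; first exact: mulr_ge0.
  by apply/exprn_ge0/ltW.
pose m := maxn m1 (Num.truncn (c / (e / 4))).
have hm : `|\int[P]_w F (b w) - \int[P]_w F (polygonal m.+1 (sample m.+1 (b w)))| <= e / 4.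
  by apply: hm1; rewrite /= leq_max leqnn.
have cm : L * (144 * maximal_constant R / (m.+1%:R * del ^+ 3)) <= e / 4.
  have m0 : 0 < m.+1%:R :> R by rewrite ltr0n.
  have d3 : 0 < del ^+ 3 by rewrite exprn_gt0.
  rewrite [leLHS](_ : _ = c / m.+1%:R); last by rewrite /c; field; lra.
  rewrite ler_pdivrMr// mulrC -ler_pdivrMr// ltW// (lt_le_trans (truncnS_gt _))//.
  by rewrite ler_nat ltnS leq_max leqnn orbT.
have cp := fd_cvg_polygonal (ltn0Sn m) L0 FL.
have /cvgrPdist_le/(_ _ e4) np := cp.
near=> n.
have mn : (m.+1 <= n)%N by near: n; exists m.+1.
have h1 : `|mexp (fun v : {ffun 'I_n -> 'I_n.+1} => F (path n v)) -
   mexp (fun v : {ffun 'I_n -> 'I_n.+1} => F (polygonal m.+1 (sample m.+1 (path n v))))| <= e / 4 + e / 4.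
  apply: le_trans (mexp_polygonal (ltn0Sn m) mn L0 FL del0) _.
  by rewrite mulrDr lerD.
have h2 : `|\int[P]_w F (polygonal m.+1 (sample m.+1 (b w))) -
   mexp (fun v : {ffun 'I_n -> 'I_n.+1} => F (polygonal m.+1 (sample m.+1 (path n v))))| <= e / 4 by near: n.
move: hm h1 h2 => /ler_normlP[a1 a2] /ler_normlP[b1 b2] /ler_normlP[c1 c2].
rewrite ler_norml; apply/andP; split; lra.
Unshelve. all: by end_near.
Qed.

(** F dominates each of its envelopes, to which lipschitz_limit applies, and the
    means of the envelopes at b increase to that of F. *)
Lemma continuous_lower_limit (F : C01 R -> R) M (e : R) : continuous F ->
  (forall x, `|F x| <= M) -> 0 < e ->
  \forall n \near \oo, \int[P]_w F (b w) - e <= mexp (fun v : {ffun 'I_n -> 'I_n.+1} => F (path n v)).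
Proof.
move=> cF FM e0; have e2 : 0 < e / 2 by rewrite divr_gt0.
have env_cont (k : nat) : continuous (envelope F k%:R).
  by apply: (@lipschitz_C01_continuous _ k%:R) => //; exact: (envelope_lipschitz FM).
have cE : \int[P]_w envelope F k%:R (b w) @[k --> \oo] --> \int[P]_w F (b w).
  apply: (@bounded_cvg_Rintegral _ _ _ _ _ _ M) => [k|k w|w].
  - by apply: (measurableT_comp (continuous_C01_measurable (@env_cont k))).
  - exact: (envelope_bounded FM).
  - exact: (envelope_cvg FM).
have /cvgrPdist_le/(_ _ e2)[k _ hk] := cE.
have /ler_normlP[h1 h2] := hk k (leqnn k).
have k0 : 0 <= k%:R :> R by [].
have := lipschitz_limit k0 (envelope_lipschitz FM k0) (fun x => envelope_bounded FM x k0).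
move=> /cvgrPdist_le/(_ _ e2) nk.
near=> n.
have /ler_normlP[h3 h4] : `|\int[P]_w envelope F k%:R (b w) -
  mexp (fun v : {ffun 'I_n -> 'I_n.+1} => envelope F k%:R (path n v))| <= e / 2 by near: n.
have h5 : mexp (fun v : {ffun 'I_n -> 'I_n.+1} => envelope F k%:R (path n v)) <=
   mexp (fun v : {ffun 'I_n -> 'I_n.+1} => F (path n v)).
  by apply: mexp_le => v; exact: (envelope_le_fun FM).
lra.
Unshelve. all: by end_near.
Qed.

(** The lower bound applied to F and to - F. *)
Lemma continuous_limit (F : C01 R -> R) M : continuous F -> (forall x, `|F x| <= M) ->
  mexp (fun v : {ffun 'I_n -> 'I_n.+1} => F (path n v)) @[n --> \oo] --> \int[P]_w F (b w).
Proof.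
move=> cF FM; apply/cvgrPdist_le => e e0.
have low := continuous_lower_limit cF FM e0.
pose G x := -1 * F x.
have cG : continuous G.
  by move=> x; apply: (@continuousM _ _ (cst (-1)) F); [exact: cst_continuous|exact: cF].
have GM x : `|G x| <= M by rewrite normrM normrN1 mul1r.
have upp := continuous_lower_limit cG GM e0.
have iF : integr P (fun w => F (b w)).
  apply: (@integr_bounded _ _ _ _ _ M) => [|w]; last exact: FM.
  by apply: (measurableT_comp (continuous_C01_measurable cF)).
near=> n.
have l1 : \int[P]_w F (b w) - e <= mexp (fun v : {ffun 'I_n -> 'I_n.+1} => F (path n v)) by near: n.
have : \int[P]_w G (b w) - e <= mexp (fun v : {ffun 'I_n -> 'I_n.+1} => G (path n v)) by near: n.
rewrite /G mexpZ RintegralZl// => l2.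
by rewrite ler_norml; apply/andP; split; lra.
Unshelve. all: by end_near.
Qed.

End bridge_gaussian.

Theorem proposition2 (R : realType)
    (d : measure_display) (T : measurableType d) (P : probability T R)
    (Poi : nat -> {RV P >-> nat})
    (Poi_indep : mutually_independent Poi)
    (Poi_law : forall j, is_poisson 1 (Poi j))
    (d' : measure_display) (T' : measurableType d') (P' : probability T' R)
    (b : {RV P' >-> borel (C01 R)})
    (b_bridge : brownian_bridge b) :
  weak_cvg (bridge_law Poi) (distribution P' b).
Proof.
move=> f cf [M fM].
have mf := continuous_C01_measurable cf.
have ib : integr P' (fun w => f (b w)).
  by apply: (integr_bounded _ _ (fun w => fM (b w))); exact: (measurableT_comp mf).
rewrite integral_distribution//; last exact/measurable_EFinP.
have -> : (\int[P']_w (EFin \o f \o b) w)%E = (\int[P']_w f (b w))%:E.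
  by rewrite fineK//; exact: integrable_fin_num.
have c := continuous_limit b_bridge cf fM.
have cE : (mexp (fun v : {ffun 'I_n -> 'I_n.+1} =>
    f (scaled_path (bridge_walk R v) n)))%:E @[n --> \oo] --> (\int[P']_w f (b w))%:E.
  by apply: cvg_EFin; [exact: nearW|exact: c].
apply: cvg_trans cE; apply: near_eq_cvg; exists 1%N => // n n0.
by rewrite (bridge_law_integral Poi_indep Poi_law n0 mf)//; exists M.
Qed.
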